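(* The coproduct $\Delta$ given on the generators of the operad $\mathrm{Ram}$ by $$\Delta(E_{i,j})=E_{i,j}\otimes E_{i,j},$$ $$\Delta(L_{i,j})=E_{i,j}\otimes L_{i,j}+L_{i,j}\otimes E_{i,j},$$ $$\Delta(\Omega_{i,j})=E_{i,j}\otimes\Omega_{i,j}+\Omega_{i,j}\otimes E_{i,j}$$ endows $\mathrm{Ram}$ with a structure of Hopf operad.
   Context: The ground field is $\mathbb{C}$. Everything takes place in the symmetric monoidal category of $(\mathbb{Z},\mathbb{Z})$-bigraded vector spaces, where the Koszul sign rule in the symmetry isomorphism of the tensor product uses only the first degree. An operad $\mathcal{P}$ is a functor from the category of finite sets and bijections to this category, with composition maps $\circ_\star:\mathcal{P}(I\sqcup\{\star\})\otimes\mathcal{P}(J)\to\mathcal{P}(I\sqcup J)$ for all finite sets $I,J$ satisfying the usual axioms of an operad (partial compositions). ''Symmetric'' means $X_{i,j}=X_{j,i}$; ''antisymmetric'' means $X_{i,j}=-X_{j,i}$. The sign $\sum_{cycl}$ denotes the sum over the three cyclic permutations of $i,j,k$. $\mathrm{Ram}$ is the operad generated by $E_{i,j}$ symmetric of degree $(0,0)$, $L_{i,j}$ antisymmetric of degree $(0,1)$ and $\Omega_{i,j}$ antisymmetric of degree $(1,1)$, modulo the relations $$E_{i,\star}\circ_\star E_{j,k}=E_{j,\star}\circ_\star E_{k,i},$$ $$\sum_{cycl}L_{i,\star}\circ_\star L_{j,k}=0,$$ $$\sum_{cycl}\left(\Omega_{i,\star}\circ_\star L_{j,k}+L_{i,\star}\circ_\star\Omega_{j,k}\right)=0,$$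 $$L_{i,\star}\circ_\star E_{j,k}=E_{j,\star}\circ_\star L_{i,k}+E_{k,\star}\circ_\star L_{i,j},$$ $$\Omega_{i,\star}\circ_\star E_{j,k}=E_{j,\star}\circ_\star\Omega_{i,k}+E_{k,\star}\circ_\star\Omega_{i,j}.$$ A Hopf operad is an operad in the category of coalgebras: each $\mathcal{P}(I)$ carries a coalgebra structure $\Delta:\mathcal{P}(I)\to\mathcal{P}(I)\otimes\mathcal{P}(I)$, natural in $I$, such that the composition maps are morphisms of coalgebras. The coproduct of $\mathrm{Ram}$ is extended from generators to all of $\mathrm{Ram}$ by requiring compatibility with composition. *)

(* Defs.v *)
From HB Require Import structures.
From mathcomp Require Import all_boot all_order all_algebra.
From mathcomp Require Import boolp classical_sets functions cardinality reals.
From mathcomp Require Import complex.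
Set Implicit Arguments.
Unset Strict Implicit.
Unset Printing Implicit Defensive.
Import GRing.Theory.
Local Open Scope classical_set_scope.
Local Open Scope ring_scope.

(** * Finite sets and bijections *)

(* The carriers are in [Set] so that [ram_term] below, whose constructors
   quantify over finite sets, fits in the universe of [lmodType]. *)
Record finSet := FinSet {
  fcar :> Set;
  fcar_finite : finite_set [set: fcar]
}.

Record bij (I J : finSet) := Bij {
  bij_fun :> I -> J;
  bij_bij : bijective bij_fun
}.

Lemma bij_eq (I J : finSet) (f g : bij I J) : f =1 g -> f = g.
Proof.
case: f => f hf; case: g => g hg /= /funext fg.
by subst g; rewrite (Prop_irrelevance hf hg).
Qed.

Lemma enum_finite (T : Type) (s : seq T) :
  (forall x, exists i, onth s i = Some x) -> finite_set [set: T].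
Proof.
case: s => [|x0 s] h.
  suff -> : [set: T] = set0 by exact: finite_set0.
  by apply/seteqP; split=> // x _; have [[]] := h x.
have -> : [set: T] = [set nth x0 (x0 :: s) i | i in `I_(size (x0 :: s))].
  apply/seteqP; split=> // x _; have [i hi] := h x.
  have lt : (i < size (x0 :: s))%N.
    by rewrite ltnNge; apply/negP => /onth_default hn; rewrite hn in hi.
  by exists i => //; exact: onth_nth.
exact: finite_image.
Qed.

Definition voidF := @FinSet void
  (@enum_finite void [::] (fun x => match x with end)).

Lemma unit_finite : finite_set [set: unit].
Proof. by apply: (@enum_finite _ [:: tt]) => -[]; exists 0%N. Qed.
Definition unitF := @FinSet unit unit_finite.

Lemma bool_finite : finite_set [set: bool].
Proof.
by apply: (@enum_finite _ [:: true; false]) => -[]; [exists 0%N|exists 1%N].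
Qed.
Definition boolF := @FinSet bool bool_finite.

Lemma option_finite (I : finSet) : finite_set [set: option I].
Proof.
have -> : [set: option I] = (Some @` [set: I] `|` [set None])%classic.
  by apply/seteqP; split=> // -[x|] _; [left; exists x|right].
by rewrite finite_setU; split; [apply/finite_image/fcar_finite|].
Qed.
(* [option I] is I ⊔ {⋆}, with ⋆ = [None]. *)
Definition optF (I : finSet) := @FinSet (option I) (option_finite I).

Lemma sum_finite (I J : finSet) : finite_set [set: (I + J)%type].
Proof.
have -> : [set: (I + J)%type] = (inl @` [set: I] `|` inr @` [set: J])%classic.
  by apply/seteqP; split=> // -[x|x] _; [left; exists x|right; exists x].
by rewrite finite_setU; split; apply/finite_image/fcar_finite.
Qed.
Definition sumF (I J : finSet) := @FinSet (I + J)%type (sum_finite I J).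

Lemma id_bijP (I : finSet) : bijective (@id I). Proof. by exists id. Qed.
Definition id_bij (I : finSet) : bij I I := Bij (id_bijP I).

Definition comp_bij (I J L : finSet) (g : bij J L) (f : bij I J) : bij I L :=
  Bij (bij_comp (bij_bij g) (bij_bij f)).

Lemma omap_bijP (I J : finSet) (f : bij I J) :
  bijective (omap f : optF I -> optF J).
Proof.
have [g fK gK] := bij_bij f.
by exists (omap g) => -[x|] //=; rewrite (fK, gK).
Qed.
Definition omap_bij (I J : finSet) (f : bij I J) : bij (optF I) (optF J) :=
  Bij (omap_bijP f).

Definition sum_map (A B A' B' : Type) (f : A -> A') (g : B -> B')
    (x : A + B) : A' + B' :=
  match x with inl a => inl (f a) | inr b => inr (g b) end.
Lemma sum_bijP (I J I' J' : finSet) (f : bij I I') (g : bij J J') :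
  bijective (sum_map f g : sumF I J -> sumF I' J').
Proof.
have [f' fK f'K] := bij_bij f; have [g' gK g'K] := bij_bij g.
by exists (sum_map f' g') => -[x|x] /=; rewrite ?(fK, gK, f'K, g'K).
Qed.
Definition sum_bij (I J I' J' : finSet) (f : bij I I') (g : bij J J') :
  bij (sumF I J) (sumF I' J') := Bij (sum_bijP f g).

(* I ⊔ (J ⊔ {⋆}) ≅ (I ⊔ J) ⊔ {⋆} *)
Definition star_r (I J : Type) (x : I + option J) : option (I + J) :=
  match x with
  | inl i => Some (inl i) | inr (Some j) => Some (inr j) | inr None => None
  end.
Lemma star_r_bijP (I J : finSet) :
  bijective (@star_r I J : sumF I (optF J) -> optF (sumF I J)).
Proof.
exists (fun y => match y with
  | Some (inl i) => inl i | Some (inr j) => inr (Some j) | None => inr None end).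
all: by [case=> [i|[j|]] | case=> [[i|j]|]].
Qed.
Definition star_r_bij (I J : finSet) := Bij (star_r_bijP I J).

(* (I ⊔ {⋆}) ⊔ J ≅ (I ⊔ J) ⊔ {⋆} *)
Definition star_l (I J : Type) (x : option I + J) : option (I + J) :=
  match x with
  | inl (Some i) => Some (inl i) | inl None => None | inr j => Some (inr j)
  end.
Lemma star_l_bijP (I J : finSet) :
  bijective (@star_l I J : sumF (optF I) J -> optF (sumF I J)).
Proof.
exists (fun y => match y with
  | Some (inl i) => inl (Some i) | Some (inr j) => inr j | None => inl None end).
all: by [case=> [[i|]|j] | case=> [[i|j]|]].
Qed.
Definition star_l_bij (I J : finSet) := Bij (star_l_bijP I J).

(* exchanges the two marked points of (I ⊔ {⋆'}) ⊔ {⋆} *)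
Definition swap_stars (I : Type) (x : option (option I)) : option (option I) :=
  match x with
  | Some (Some i) => Some (Some i) | Some None => None | None => Some None
  end.
Lemma swap_stars_bijP (I : finSet) :
  bijective (@swap_stars I : optF (optF I) -> optF (optF I)).
Proof. by exists (@swap_stars I); case=> [[i|]|]. Qed.
Definition swap_stars_bij (I : finSet) := Bij (swap_stars_bijP I).

Definition sum_assoc (I J L : Type) (x : I + (J + L)) : (I + J) + L :=
  match x with
  | inl i => inl (inl i) | inr (inl j) => inl (inr j) | inr (inr l) => inr l
  end.
Lemma sum_assoc_bijP (I J L : finSet) :
  bijective (@sum_assoc I J L : sumF I (sumF J L) -> sumF (sumF I J) L).
Proof.
exists (fun y => match y with
  | inl (inl i) => inl i | inl (inr j) => inr (inl j) | inr l => inr (inr l)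
  end).
all: by [case=> [i|[j|l]] | case=> [[i|j]|l]].
Qed.
Definition sum_assoc_bij (I J L : finSet) := Bij (sum_assoc_bijP I J L).

Definition sum_swap_r (I J L : Type) (x : (I + J) + L) : (I + L) + J :=
  match x with
  | inl (inl i) => inl (inl i) | inl (inr j) => inr j | inr l => inl (inr l)
  end.
Lemma sum_swap_r_bijP (I J L : finSet) :
  bijective (@sum_swap_r I J L : sumF (sumF I J) L -> sumF (sumF I L) J).
Proof. by exists (@sum_swap_r I L J); case=> [[i|j]|l]. Qed.
Definition sum_swap_r_bij (I J L : finSet) := Bij (sum_swap_r_bijP I J L).

(* I ⊔ {i} ≅ I ⊔ {⋆} *)
Definition unit_r (I : Type) (x : I + unit) : option I :=
  match x with inl i => Some i | inr _ => None end.
Lemma unit_r_bijP (I : finSet) :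
  bijective (@unit_r I : sumF I unitF -> optF I).
Proof.
exists (fun y => match y with Some i => inl i | None => inr tt end).
all: by [case=> [i|[]] | case].
Qed.
Definition unit_r_bij (I : finSet) := Bij (unit_r_bijP I).

(* {i} ≅ ∅ ⊔ {⋆} *)
Lemma unit_star_bijP : bijective ((fun _ => None) : unitF -> optF voidF).
Proof. by exists (fun _ => tt) => -[]. Qed.
Definition unit_star_bij := Bij unit_star_bijP.

(* ∅ ⊔ J ≅ J *)
Definition void_l (J : Type) (x : void + J) : J :=
  match x with inl v => match v with end | inr j => j end.
Lemma void_l_bijP (J : finSet) : bijective (@void_l J : sumF voidF J -> J).
Proof. by exists (fun j => inr j) => // -[[]|]. Qed.
Definition void_l_bij (J : finSet) := Bij (void_l_bijP J).

(** * Bigraded vector spaces *)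

Definition bideg : zmodType := (int * int)%type.

Section Bigraded.
Variable K : fieldType.

Definition bgspace := bideg -> lmodType K.

(* morphisms, of bidegree 0 *)
Definition bgmap (V W : bgspace) := forall d, {linear V d -> W d}.

(* sign (-1)^(|x||y|), where only the first degree counts *)
Definition ksign (a b : bideg) : K := (-1) ^ (a.1 * b.1).

(* Formal expressions with a class of evaluations into modules.  [lquot M]
   identifies two expressions when all evaluations agree on them; taking all
   models of an equational theory, this is the quotient by the congruence
   which the theory generates. *)
Record premod := Premod {
  pm_sort :> Type;
  pm_zero : pm_sort;
  pm_add : pm_sort -> pm_sort -> pm_sort;
  pm_scale : K -> pm_sort -> pm_sort;
  pm_model : Type;
  pm_val : pm_model -> lmodType K;
  pm_ev : forall m, pm_sort -> pm_val m;
  pm_ev0 : forall m, pm_ev m pm_zero = 0;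
  pm_evD : forall m x y, pm_ev m (pm_add x y) = pm_ev m x + pm_ev m y;
  pm_evZ : forall m k x, pm_ev m (pm_scale k x) = k *: pm_ev m x
}.

Section LQuot.
Variable M : premod.

Definition pm_eq (x y : {classic M}) : bool :=
  `[< forall m : pm_model M, pm_ev m x = pm_ev m y >].

Lemma pm_eq_equiv : equiv_class_of pm_eq.
Proof.
split=> [x|x y|y x z].
- exact/asboolP.
- by apply/asboolP/asboolP => h m; rewrite h.
- by move=> /asboolP xy /asboolP yz; apply/asboolP => m; rewrite xy yz.
Qed.
Canonical pm_equiv := EquivRelPack pm_eq_equiv.

Definition lquot : Type := {eq_quot pm_eq}%qT.
HB.instance Definition _ := Choice.on lquot.

Definition lpi (x : M) : lquot := (\pi_({eq_quot pm_eq}) (x : {classic M}))%qT.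
Definition lrepr (x : lquot) : M := repr (x : {eq_quot pm_eq}%qT).

Lemma lreprK x : lpi (lrepr x) = x.
Proof. exact: reprK. Qed.

Lemma lpiP x y : (lpi x = lpi y) <-> (forall m, pm_ev m x = pm_ev m y).
Proof.
split=> [/eqmodP/asboolP //|h].
exact/eqmodP/asboolP.
Qed.

Lemma pm_ev_repr m x : pm_ev m (lrepr (lpi x)) = pm_ev m x.
Proof. exact: (lpiP _ _).1 (lreprK _) m. Qed.

Definition lq_add x y := lpi (pm_add (lrepr x) (lrepr y)).
Definition lq_opp x := lpi (pm_scale (-1) (lrepr x)).
Definition lq_scale k x := lpi (pm_scale k (lrepr x)).
Let evE := (pm_ev_repr, pm_evD, pm_evZ, pm_ev0).

Lemma lq_addA : associative lq_add.
Proof. by move=> x y z; apply/lpiP => m; rewrite !evE addrA. Qed.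
Lemma lq_addC : commutative lq_add.
Proof. by move=> x y; apply/lpiP => m; rewrite !evE addrC. Qed.
Lemma lq_add0 : left_id (lpi (pm_zero M)) lq_add.
Proof.
by move=> x; rewrite -[RHS]lreprK; apply/lpiP => m; rewrite !evE add0r.
Qed.
Lemma lq_addN : left_inverse (lpi (pm_zero M)) lq_opp lq_add.
Proof. by move=> x; apply/lpiP => m; rewrite !evE scaleN1r addNr. Qed.
HB.instance Definition _ :=
  GRing.isZmodule.Build lquot lq_addA lq_addC lq_add0 lq_addN.

Lemma lq_scaleA k l x : lq_scale k (lq_scale l x) = lq_scale (k * l) x.
Proof. by apply/lpiP => m; rewrite !evE scalerA. Qed.
Lemma lq_scale1 : left_id 1 lq_scale.
Proof.
by move=> x; rewrite -[RHS]lreprK; apply/lpiP => m; rewrite !evE scale1r.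
Qed.
Lemma lq_scaleDr : right_distributive lq_scale +%R.
Proof. by move=> k x y; apply/lpiP => m; rewrite !evE scalerDr. Qed.
Lemma lq_scaleDl x : {morph lq_scale^~ x : k l / k + l}.
Proof. by move=> k l; apply/lpiP => m; rewrite !evE scalerDl. Qed.
HB.instance Definition _ := GRing.Zmodule_isLmodule.Build K lquot
  lq_scaleA lq_scale1 lq_scaleDr lq_scaleDl.

Lemma lpi0 : lpi (pm_zero M) = 0. Proof. by []. Qed.
Lemma lpiD x y : lpi (pm_add x y) = lpi x + lpi y.
Proof. by apply/lpiP => m; rewrite !evE. Qed.
Lemma lpiZ k x : lpi (pm_scale k x) = k *: lpi x.
Proof. by apply/lpiP => m; rewrite !evE. Qed.

Definition lev (m : pm_model M) (x : lquot) : pm_val m := pm_ev m (lrepr x).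
Lemma lev_pi m x : lev m (lpi x) = pm_ev m x.
Proof. exact: pm_ev_repr. Qed.
Lemma lev_linear m : linear (lev m).
Proof.
move=> k x y; rewrite -[x in LHS]lreprK -[y in LHS]lreprK.
by rewrite -lpiZ -lpiD lev_pi pm_evD pm_evZ.
Qed.
HB.instance Definition _ m :=
  GRing.isLinear.Build K lquot (pm_val m) _ (lev m) (lev_linear m).
Definition lev_lin (m : pm_model M) : {linear lquot -> pm_val m} := lev m.

End LQuot.
Arguments lev : simpl never.
Arguments lpi : simpl never.

(** ** Tensor product *)

(* families of bilinear maps on the summands of (V ⊗ W)_d *)
Record bilin (V W : bgspace) (d : bideg) (M : lmodType K) := Bilin {
  bilin_fun :> forall a b, a + b = d -> V a -> W b -> M;
  bilin_l : forall a b (e : a + b = d) w, linear (fun v => bilin_fun e v w);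
  bilin_r : forall a b (e : a + b = d) v, linear (bilin_fun e v)
}.

Section Tensor.
Variables (V W : bgspace) (d : bideg).

Inductive tterm : Type :=
| TZero
| TAdd of tterm & tterm
| TScale of K & tterm
| TPure a b of a + b = d & V a & W b.

Fixpoint teval (M : lmodType K) (f : bilin V W d M) (t : tterm) : M :=
  match t with
  | TZero => 0
  | TAdd s t => teval f s + teval f t
  | TScale k t => k *: teval f t
  | TPure a b e v w => f a b e v w
  end.

Definition tens_premod : premod := @Premod tterm TZero TAdd TScale
  {M : lmodType K & bilin V W d M} (@projT1 _ _)
  (fun m => teval (projT2 m))
  (fun _ => erefl) (fun _ _ _ => erefl) (fun _ _ _ => erefl).

End Tensor.

(* (V ⊗ W)_d is the direct sum of the V_a ⊗ W_b for a + b = d *)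
Definition tens (V W : bgspace) : bgspace :=
  fun d => lquot (tens_premod V W d).
Local Notation "V ⊗ W" := (tens V W) (at level 40, left associativity).

Section TensorTheory.
Variables (V W : bgspace) (d : bideg).

Definition pure a b (e : a + b = d) (v : V a) (w : W b) : (V ⊗ W) d :=
  lpi (TPure e v w : tens_premod V W d).

Lemma pure_linear_l a b (e : a + b = d) w :
  linear (fun v : V a => pure e v (w : W b)).
Proof.
move=> k v v'; rewrite -lpiZ -lpiD; apply/lpiP => -[M f] /=.
exact: (bilin_l f).
Qed.

Lemma pure_linear_r a b (e : a + b = d) (v : V a) :
  linear (fun w : W b => pure e v w).
Proof.
move=> k w w'; rewrite -lpiZ -lpiD; apply/lpiP => -[M f] /=.
exact: (bilin_r f).
Qed.

Definition tlift (M : lmodType K) (f : bilin V W d M) :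
    {linear (V ⊗ W) d -> M} :=
  @lev_lin (tens_premod V W d) (existT (bilin V W d) M f).

Lemma tlift_pure (M : lmodType K) (f : bilin V W d M) a b (e : a + b = d) v w :
  tlift f (pure e v w) = f a b e v w.
Proof.
exact: (@lev_pi (tens_premod V W d) (existT (bilin V W d) M f) (TPure e v w)).
Qed.

Lemma tens_ind (P : (V ⊗ W) d -> Prop) :
  P 0 -> (forall x y, P x -> P y -> P (x + y)) ->
  (forall k x, P x -> P (k *: x)) ->
  (forall a b (e : a + b = d) v w, P (pure e v w)) -> forall x, P x.
Proof.
move=> P0 PD PZ Pp x; rewrite -[x]lreprK; elim: (lrepr x) => /=.
- exact: P0.
- by move=> s Ps t Pt; rewrite (lpiD (M := tens_premod V W d)); apply: PD.
- by move=> k t Pt; rewrite (lpiZ (M := tens_premod V W d)); apply: PZ.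
- exact: Pp.
Qed.

Lemma tens_ext (M : lmodType K) (f g : {linear (V ⊗ W) d -> M}) :
  (forall a b (e : a + b = d) v w, f (pure e v w) = g (pure e v w)) -> f =1 g.
Proof.
move=> fg; apply: tens_ind => //.
- by rewrite !linear0.
- by move=> x y hx hy; rewrite !linearD hx hy.
- by move=> k x hx; rewrite !linearZ_LR hx.
Qed.

Lemma tens_linear (M X : lmodType K) (F : X -> {linear (V ⊗ W) d -> M}) :
  (forall a b (e : a + b = d) v w, linear (fun z => F z (pure e v w))) ->
  forall x, linear (fun z => F z x).
Proof.
move=> h x k z z'.
apply: (tens_ext (f := F (k *: z + z')) (g := (k \*: F z \+ F z')%R)).
by move=> a b e v w; apply: h.
Qed.

End TensorTheory.

Definition tmap_bilin (V W V' W' : bgspace) (f : bgmap V V') (g : bgmap W W')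
  (d : bideg) : bilin V W d ((V' ⊗ W') d).
Proof.
exists (fun a b e v w => pure e (f a v) (g b w)).
- by move=> a b e w k v v' /=; rewrite linearP pure_linear_l.
- by move=> a b e v k w w' /=; rewrite linearP pure_linear_r.
Defined.

Definition tmap (V W V' W' : bgspace) (f : bgmap V V') (g : bgmap W W') :
  bgmap (V ⊗ W) (V' ⊗ W') := fun d => tlift (tmap_bilin f g d).

Definition bgid (V : bgspace) : bgmap V V := fun d => idfun.

Section Associator.
Variables (U V W : bgspace).

Lemma assoc_deg (a b c p d : bideg) :
  a + b = p -> p + c = d -> a + (b + c) = d.
Proof. by move=> <- <-; rewrite addrA. Qed.

Definition tassoc_inner (p c d : bideg) (e : p + c = d) (w : W c) :
  bilin U V p ((U ⊗ (V ⊗ W)) d).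
Proof.
exists (fun a b e' u v => pure (assoc_deg e' e) u (pure (erefl (b + c)) v w)).
- by move=> a b e' v k u u' /=; rewrite pure_linear_l.
- by move=> a b e' u k v v' /=; rewrite pure_linear_l pure_linear_r.
Defined.

Definition tassoc_bilin (d : bideg) : bilin (U ⊗ V) W d ((U ⊗ (V ⊗ W)) d).
Proof.
exists (fun p c e x w => tlift (tassoc_inner e w) x).
- by move=> p c e w k x y; rewrite linearP.
- move=> p c e; apply: tens_linear => a b e' u v k w w'.
  by rewrite !tlift_pure /= pure_linear_r pure_linear_r.
Defined.

Definition tassoc : bgmap ((U ⊗ V) ⊗ W) (U ⊗ (V ⊗ W)) :=
  fun d => tlift (tassoc_bilin d).

End Associator.

(* (u ⊗ v) ⊗ (u' ⊗ v') ↦ (-1)^(|v||u'|) (u ⊗ u') ⊗ (v ⊗ v') *)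
Section Interchange.
Variables (U V U' V' : bgspace).

Lemma inter_deg (a b a' b' p q d : bideg) :
  a + b = p -> a' + b' = q -> p + q = d -> (a + a') + (b + b') = d.
Proof. by move=> <- <- <-; rewrite addrACA. Qed.

Definition tinter_inner (p q d a b : bideg) (e : p + q = d) (e1 : a + b = p)
  (u : U a) (v : V b) : bilin U' V' q (((U ⊗ U') ⊗ (V ⊗ V')) d).
Proof.
exists (fun a' b' e2 u' v' => ksign b a' *:
  pure (inter_deg e1 e2 e) (pure (erefl (a + a')) u u')
       (pure (erefl (b + b')) v v')).
- move=> a' b' e2 v' k x y /=.
  by rewrite pure_linear_r pure_linear_l scalerDr !scalerA mulrC.
- move=> a' b' e2 u' k x y /=.
  by rewrite !pure_linear_r scalerDr !scalerA mulrC.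
Defined.

Definition tinter_middle (p q d : bideg) (e : p + q = d) (y : (U' ⊗ V') q) :
  bilin U V p (((U ⊗ U') ⊗ (V ⊗ V')) d).
Proof.
exists (fun a b e1 u v => tlift (tinter_inner e e1 u v) y).
- move=> a b e1 v; move: y; apply: tens_linear => a' b' e2 u' v' k u w.
  rewrite !tlift_pure /= pure_linear_l pure_linear_l.
  by rewrite scalerDr !scalerA mulrC.
- move=> a b e1 u; move: y; apply: tens_linear => a' b' e2 u' v' k v w.
  rewrite !tlift_pure /= pure_linear_l pure_linear_r.
  by rewrite scalerDr !scalerA mulrC.
Defined.

Definition tinter_bilin (d : bideg) :
  bilin (U ⊗ V) (U' ⊗ V') d (((U ⊗ U') ⊗ (V ⊗ V')) d).
Proof.
exists (fun p q e x y => tlift (tinter_middle e y) x).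
- by move=> p q e y k x x'; rewrite linearP.
- move=> p q e; apply: tens_linear => a b e1 u v k y y'.
  rewrite !tlift_pure; exact: (linearP (tlift (tinter_inner e e1 u v))).
Defined.

Definition tinter : bgmap ((U ⊗ V) ⊗ (U' ⊗ V')) ((U ⊗ U') ⊗ (V ⊗ V')) :=
  fun d => tlift (tinter_bilin d).

End Interchange.

(** ** Coalgebras *)

(* The identity of V_b when b = d, and zero otherwise. *)
Definition bgcast (V : bgspace) (b d : bideg) (v : V b) : V d :=
  match b =P d with
  | ReflectT e => eq_rect b (fun x => V x : Type) v d e
  | ReflectF _ => 0
  end.

Lemma bgcast_linear (V : bgspace) (b d : bideg) : linear (@bgcast V b d).
Proof.
move=> k x y; rewrite /bgcast; case: eqP => [e|_]; last by rewrite scaler0 addr0.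
by case: d / e.
Qed.

(* Functionals to K, placed in bidegree (0,0), are families of linear forms
   which vanish outside bidegree (0,0). *)
Definition bgform (V : bgspace) := forall d, {linear V d -> K^o}.
Definition degree0 (V : bgspace) (f : bgform V) : Prop :=
  forall d x, d != 0 -> f d x = 0.

(* (f ⊗ id) : V ⊗ W -> K ⊗ W = W *)
Definition contract_l_bilin (V W : bgspace) (f : bgform V) (d : bideg) :
  bilin V W d (W d).
Proof.
exists (fun a b _ v w => f a v *: bgcast d w).
- by move=> a b _ w k v v'; rewrite linearP scalerDl scalerA.
- by move=> a b _ v k w w'; rewrite bgcast_linear scalerDr !scalerA mulrC.
Defined.
Definition contract_l (V W : bgspace) (f : bgform V) : bgmap (V ⊗ W) W :=
  fun d => tlift (contract_l_bilin W f d).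

(* (id ⊗ f) : V ⊗ W -> V ⊗ K = V *)
Definition contract_r_bilin (V W : bgspace) (f : bgform W) (d : bideg) :
  bilin V W d (V d).
Proof.
exists (fun a b _ v w => f b w *: bgcast d v).
- by move=> a b _ w k v v'; rewrite bgcast_linear scalerDr !scalerA mulrC.
- by move=> a b _ v k w w'; rewrite linearP scalerDl scalerA.
Defined.
Definition contract_r (V W : bgspace) (f : bgform W) : bgmap (V ⊗ W) V :=
  fun d => tlift (contract_r_bilin V f d).

Definition tform_bilin (V W : bgspace) (f : bgform V) (g : bgform W)
  (d : bideg) : bilin V W d K^o.
Proof.
exists (fun a b _ v w => (f a v : K) * (g b w : K)).
- by move=> a b _ w k v v'; rewrite linearP mulrDl; congr (_ + _); exact: esym (mulrA _ _ _).
- by move=> a b _ v k w w'; rewrite linearP mulrDr; congr (_ + _); exact: mulrCA.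
Defined.
Definition tform (V W : bgspace) (f : bgform V) (g : bgform W) :
  bgform (V ⊗ W) := fun d => tlift (tform_bilin f g d).

Definition bgcomul (V : bgspace) := bgmap V (V ⊗ V).

Record is_coalgebra (V : bgspace) (D : bgcomul V) (eps : bgform V) : Prop := {
  counit_degree0 : degree0 eps;
  coassoc : forall d (x : V d),
    tassoc V V V d (tmap D (bgid V) d (D d x)) = tmap (bgid V) D d (D d x);
  counit_l : forall d (x : V d), contract_l V eps d (D d x) = x;
  counit_r : forall d (x : V d), contract_r V eps d (D d x) = x
}.

(* coproduct of the tensor product of two coalgebras; its counit is [tform] *)
Definition tens_comul (V W : bgspace) (D : bgcomul V) (D' : bgcomul W) :
    bgcomul (V ⊗ W) :=
  fun d => (tinter V V W W d \o tmap D D' d)%FUN.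

Definition comul_morph (V W : bgspace) (D : bgcomul V) (D' : bgcomul W)
    (f : bgmap V W) : Prop :=
  forall d (x : V d), D' d (f d x) = tmap f f d (D d x).

Definition counit_morph (V W : bgspace) (eps : bgform V) (eps' : bgform W)
    (f : bgmap V W) : Prop :=
  forall d (x : V d), eps' d (f d x) = eps d x.

(** * Operads *)

Record operad := Operad {
  op_obj :> finSet -> bgspace;
  op_map : forall I J : finSet, bij I J -> bgmap (op_obj I) (op_obj J);
  (* x ∘_⋆ y, in any degree equal to the sum of the degrees of x and y *)
  op_comp : forall (I J : finSet) (a b c : bideg), a + b = c ->
    op_obj (optF I) a -> op_obj J b -> op_obj (sumF I J) c;
  op_unit : op_obj unitF 0;
  op_map_id : forall I d (x : op_obj I d), op_map (id_bij I) d x = x;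
  op_map_comp : forall I J L (f : bij I J) (g : bij J L) d (x : op_obj I d),
    op_map (comp_bij g f) d x = op_map g d (op_map f d x);
  op_comp_linear_l : forall I J a b c (e : a + b = c) (y : op_obj J b),
    linear (fun x : op_obj (optF I) a => op_comp e x y);
  op_comp_linear_r : forall I J a b c (e : a + b = c) (x : op_obj (optF I) a),
    linear (fun y : op_obj J b => op_comp e x y);
  op_comp_nat : forall I J I' J' (f : bij I I') (g : bij J J') a b c
      (e : a + b = c) (x : op_obj (optF I) a) (y : op_obj J b),
    op_comp e (op_map (omap_bij f) a x) (op_map g b y) =
    op_map (sum_bij f g) c (op_comp e x y);
  op_comp_seq : forall I J L a b c ab bc d (e1 : a + b = ab) (e2 : ab + c = d)
      (e3 : b + c = bc) (e4 : a + bc = d) (x : op_obj (optF I) a)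
      (y : op_obj (optF J) b) (z : op_obj L c),
    op_comp e2 (op_map (star_r_bij I J) ab (op_comp e1 x y)) z =
    op_map (sum_assoc_bij I J L) d (op_comp e4 x (op_comp e3 y z));
  op_comp_par : forall I J L a b c ab ac d (e1 : a + b = ab) (e2 : ab + c = d)
      (e3 : a + c = ac) (e4 : ac + b = d) (x : op_obj (optF (optF I)) a)
      (y : op_obj J b) (z : op_obj L c),
    op_map (sum_swap_r_bij I J L) d
      (op_comp e2 (op_map (star_l_bij I J) ab (op_comp e1 x y)) z) =
    ksign b c *:
      op_comp e4 (op_map (star_l_bij I L) ac
        (op_comp e3 (op_map (swap_stars_bij I) a x) z)) y;
  op_unit_r : forall I a (e : a + 0 = a) (x : op_obj (optF I) a),
    op_map (unit_r_bij I) a (op_comp e x op_unit) = x;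
  op_unit_l : forall J b (e : 0 + b = b) (y : op_obj J b),
    op_map (void_l_bij J) b
      (op_comp e (op_map unit_star_bij 0 op_unit) y) = y
}.

Definition op_comp_bilin (P : operad) (I J : finSet) (d : bideg) :
    bilin (P (optF I)) (P J) d (P (sumF I J) d) :=
  Bilin (fun a b e y => @op_comp_linear_l P I J a b d e y)
        (fun a b e x => @op_comp_linear_r P I J a b d e x).

Definition op_comp_map (P : operad) (I J : finSet) :
    bgmap (P (optF I) ⊗ P J) (P (sumF I J)) :=
  fun d => tlift (op_comp_bilin P I J d).

(* coproducts compatible with the whole operad structure *)
Record operad_comul (P : operad) (D : forall I, bgcomul (P I)) : Prop := {
  comul_map : forall I J (f : bij I J), comul_morph (D I) (D J) (op_map P f);
  comul_comp : forall I J, comul_morph (tens_comul (D (optF I)) (D J))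
    (D (sumF I J)) (op_comp_map P I J);
  comul_unit : D unitF 0 (op_unit P) =
    pure (addr0 (0 : bideg)) (op_unit P) (op_unit P)
}.

Record hopf_operad (P : operad) (D : forall I, bgcomul (P I))
    (eps : forall I, bgform (P I)) : Prop := {
  hopf_coalgebra : forall I, is_coalgebra (D I) (eps I);
  hopf_comul : operad_comul D;
  hopf_counit_map : forall I J (f : bij I J),
    counit_morph (eps I) (eps J) (op_map P f);
  hopf_counit_comp : forall I J,
    counit_morph (tform (eps (optF I)) (eps J)) (eps (sumF I J))
      (op_comp_map P I J);
  hopf_counit_unit : eps unitF 0 (op_unit P) = 1
}.

End Bigraded.

Arguments op_comp {K} _ {I J a b c} e x y.
Arguments op_map {K} _ {I J} f d.

(** * The operad Ram *)

(* false ↦ i, true ↦ j *)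
Definition of_pair (T : Type) (i j : T) (b : bool) : T := if b then j else i.
Definition of_triple (T : Type) (i j k : T) (s : unit + bool) : T :=
  match s with inl _ => i | inr b => of_pair j k b end.

(* i, j (resp. i, j, k) are distinct and exhaust T *)
Definition enum2 (T : finSet) (i j : T) : Prop :=
  bijective (of_pair i j : boolF -> T).
Definition enum3 (T : finSet) (i j k : T) : Prop :=
  bijective (of_triple i j k : sumF unitF boolF -> T).

Lemma enum2C (T : finSet) (i j : T) : enum2 i j -> enum2 j i.
Proof.
move=> h; apply: (eq_bij (bij_comp h (inv_bij negbK))) => -[] //=.
Qed.

Lemma enum3_rot (T : finSet) (i j k : T) : enum3 i j k -> enum3 j k i.
Proof.
move=> h; pose r (s : unit + bool) : unit + bool :=
  match s with inl _ => inr false | inr false => inr true | _ => inl tt end.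
have r_bij : bijective r by exists (r \o r) => -[[]|[]].
by apply: (eq_bij (bij_comp h r_bij)) => -[[]|[]].
Qed.

Lemma enum3_swap (T : finSet) (i j k : T) : enum3 i j k -> enum3 j i k.
Proof.
move=> h; pose r (s : unit + bool) : unit + bool :=
  match s with inl _ => inr false | inr false => inl tt | _ => inr true end.
have r_bij : bijective r by exists r => -[[]|[]].
by apply: (eq_bij (bij_comp h r_bij)) => -[[]|[]].
Qed.

Lemma enum_star : @enum2 (optF unitF) (Some tt) None.
Proof.
by exists (fun x => if x is Some _ then false else true); [case|case=> [[]|]].
Qed.

Definition degE : bideg := 0.
Definition degL : bideg := (0, 1).
Definition degO : bideg := (1, 1).

Lemma degEE : degE + degE = degE. Proof. exact: addr0. Qed.
Lemma degEL : degE + degL = degL. Proof. exact: add0r. Qed.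
Lemma degLE : degL + degE = degL. Proof. exact: addr0. Qed.
Lemma degEO : degE + degO = degO. Proof. exact: add0r. Qed.
Lemma degOE : degO + degE = degO. Proof. exact: addr0. Qed.
Lemma degLO : degL + degO = degO + degL. Proof. exact: addrC. Qed.

Section Ram.
Variable K : fieldType.

Section Relations.
Variable P : operad K.

(* X_{i,j} in P({i,j}), for X = X_{false,true} in P(bool) *)
Definition gen2 d (X : P boolF d) (T : finSet) (i j : T) (h : enum2 i j) :
  P T d := op_map P (Bij h) d X.

(* X_{i,⋆} ∘_⋆ Y_{j,k} in P({i,j,k}) *)
Definition graft a b c (e : a + b = c) (X : P boolF a) (Y : P boolF b)
    (T : finSet) (i j k : T) (h : enum3 i j k) : P T c :=
  op_map P (Bij h) c (op_comp P e (gen2 X enum_star) Y).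

Record ram_relations (E : P boolF degE) (L : P boolF degL)
    (O : P boolF degO) : Prop := {
  ram_E_sym : forall (T : finSet) (i j : T) (h : enum2 i j),
    gen2 E (enum2C h) = gen2 E h;
  ram_L_asym : forall (T : finSet) (i j : T) (h : enum2 i j),
    gen2 L (enum2C h) = - gen2 L h;
  ram_O_asym : forall (T : finSet) (i j : T) (h : enum2 i j),
    gen2 O (enum2C h) = - gen2 O h;
  ram_EE : forall (T : finSet) (i j k : T) (h : enum3 i j k),
    graft degEE E E h = graft degEE E E (enum3_rot h);
  ram_LL : forall (T : finSet) (i j k : T) (h : enum3 i j k),
    let LL (i j k : T) (h : enum3 i j k) := graft erefl L L h in
    LL _ _ _ h + LL _ _ _ (enum3_rot h)
      + LL _ _ _ (enum3_rot (enum3_rot h)) = 0;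
  ram_OL : forall (T : finSet) (i j k : T) (h : enum3 i j k),
    let OL_LO (i j k : T) (h : enum3 i j k) :=
      graft erefl O L h + graft degLO L O h in
    OL_LO _ _ _ h + OL_LO _ _ _ (enum3_rot h)
      + OL_LO _ _ _ (enum3_rot (enum3_rot h)) = 0;
  ram_LE : forall (T : finSet) (i j k : T) (h : enum3 i j k),
    graft degLE L E h =
      graft degEL E L (enum3_swap h) + graft degEL E L (enum3_rot (enum3_rot h));
  ram_OE : forall (T : finSet) (i j k : T) (h : enum3 i j k),
    graft degOE O E h =
      graft degEO E O (enum3_swap h) + graft degEO E O (enum3_rot (enum3_rot h))
}.

End Relations.

Record ram_model := RamModel {
  rm_op :> operad K;
  rm_E : rm_op boolF degE;
  rm_L : rm_op boolF degL;
  rm_O : rm_op boolF degO;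
  rm_rel : ram_relations rm_E rm_L rm_O
}.

(* Ram is generated by E, L, Ω modulo [ram_relations]: its elements are the
   formal composites of the generators, two of them being identified when they
   are equal in every operad with elements E, L, Ω satisfying the relations.
   It satisfies the relations and is initial among such operads
   ([Ram_relations], [ram_lift_gen], [ram_lift_unique]). *)
Inductive ram_term : finSet -> bideg -> Type :=
| RZero I d : ram_term I d
| RAdd I d : ram_term I d -> ram_term I d -> ram_term I d
| RScale I d : K -> ram_term I d -> ram_term I d
| RE : ram_term boolF degE
| RL : ram_term boolF degL
| RO : ram_term boolF degO
| RUnit : ram_term unitF 0
| RMap I J d : bij I J -> ram_term I d -> ram_term J d
| RComp I J a b c : a + b = c ->
    ram_term (optF I) a -> ram_term J b -> ram_term (sumF I J) c.

Fixpoint ram_eval (M : ram_model) I d (t : ram_term I d) : M I d :=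
  match t in ram_term I d return M I d with
  | RZero _ _ => 0
  | RAdd _ _ s t => ram_eval M s + ram_eval M t
  | RScale _ _ k t => k *: ram_eval M t
  | RE => rm_E M
  | RL => rm_L M
  | RO => rm_O M
  | RUnit => op_unit M
  | RMap _ _ d f t => op_map M f d (ram_eval M t)
  | RComp _ _ _ _ _ e s t => op_comp M e (ram_eval M s) (ram_eval M t)
  end.

Definition ram_premod (I : finSet) (d : bideg) : premod K :=
  @Premod K (ram_term I d) (RZero I d) (@RAdd I d) (@RScale I d)
    ram_model (fun M => M I d : lmodType K) (fun M => @ram_eval M I d)
    (fun _ => erefl) (fun _ _ _ => erefl) (fun _ _ _ => erefl).

Definition ram_obj (I : finSet) : bgspace K := fun d => lquot (ram_premod I d).

Definition rpi I d (t : ram_term I d) : ram_obj I d := lpi (t : ram_premod I d).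
Definition rrep I d (x : ram_obj I d) : ram_term I d :=
  lrepr (x : lquot (ram_premod I d)).

Lemma rpiP I d (s t : ram_term I d) :
  (forall M, ram_eval M s = ram_eval M t) -> rpi s = rpi t.
Proof. by move=> h; apply/lpiP. Qed.
Lemma rrepK I d (x : ram_obj I d) : rpi (rrep x) = x.
Proof. exact: lreprK. Qed.
Lemma ram_eval_rep M I d (t : ram_term I d) :
  ram_eval M (rrep (rpi t)) = ram_eval M t.
Proof. exact: (@pm_ev_repr _ (ram_premod I d) M t). Qed.
Lemma rpiD I d (s t : ram_term I d) : rpi (RAdd s t) = rpi s + rpi t.
Proof. exact: (@lpiD _ (ram_premod I d)). Qed.
Lemma rpiZ I d k (t : ram_term I d) : rpi (RScale k t) = k *: rpi t.
Proof. exact: (@lpiZ _ (ram_premod I d)). Qed.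

Definition ram_map_fun I J (f : bij I J) d (x : ram_obj I d) : ram_obj J d :=
  rpi (RMap f (rrep x)).
Definition ram_comp I J a b c (e : a + b = c) (x : ram_obj (optF I) a)
  (y : ram_obj J b) : ram_obj (sumF I J) c := rpi (RComp e (rrep x) (rrep y)).

Lemma ram_map_linear I J (f : bij I J) d : linear (@ram_map_fun I J f d).
Proof.
move=> k x y; rewrite -rpiZ -rpiD -[x in LHS]rrepK -[y in LHS]rrepK.
rewrite -rpiZ -rpiD; apply: rpiP => M /=.
by rewrite ram_eval_rep /= linearP.
Qed.
HB.instance Definition _ I J (f : bij I J) d :=
  GRing.isLinear.Build K (ram_obj I d) (ram_obj J d) _ (@ram_map_fun I J f d)
    (@ram_map_linear I J f d).
Definition ram_map I J (f : bij I J) : bgmap (ram_obj I) (ram_obj J) :=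
  fun d => @ram_map_fun I J f d.

Lemma ram_map_pi I J (f : bij I J) d (t : ram_term I d) :
  ram_map f d (rpi t) = rpi (RMap f t).
Proof. by apply: rpiP => M /=; rewrite ram_eval_rep. Qed.
Lemma ram_comp_pi I J a b c (e : a + b = c) (s : ram_term (optF I) a)
  (t : ram_term J b) : ram_comp e (rpi s) (rpi t) = rpi (RComp e s t).
Proof. by apply: rpiP => M /=; rewrite !ram_eval_rep. Qed.

Lemma rpi_surj I d (x : ram_obj I d) : exists t, x = rpi t.
Proof. by exists (rrep x); rewrite rrepK. Qed.

Let piE := (ram_map_pi, ram_comp_pi).

Definition Ram : operad K.
Proof.
apply: (@Operad K ram_obj ram_map ram_comp (rpi RUnit)).
- move=> I d x; have [t ->] := rpi_surj x.
  by rewrite !piE; apply: rpiP => M /=; rewrite op_map_id.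
- move=> I J L f g d x; have [t ->] := rpi_surj x.
  by rewrite !piE; apply: rpiP => M /=; rewrite op_map_comp.
- move=> I J a b c e y k x x'.
  have [s ->] := rpi_surj x; have [s' ->] := rpi_surj x'.
  have [t ->] := rpi_surj y; rewrite -rpiZ -rpiD !piE -rpiZ -rpiD.
  by apply: rpiP => M /=; rewrite op_comp_linear_l.
- move=> I J a b c e x k y y'.
  have [s ->] := rpi_surj y; have [s' ->] := rpi_surj y'.
  have [t ->] := rpi_surj x; rewrite -rpiZ -rpiD !piE -rpiZ -rpiD.
  by apply: rpiP => M /=; rewrite op_comp_linear_r.
- move=> I J I' J' f g a b c e x y.
  have [s ->] := rpi_surj x; have [t ->] := rpi_surj y.
  by rewrite !piE; apply: rpiP => M /=; rewrite op_comp_nat.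
- move=> I J L a b c ab bc d e1 e2 e3 e4 x y z.
  have [s ->] := rpi_surj x; have [t ->] := rpi_surj y.
  have [u ->] := rpi_surj z; rewrite !piE; apply: rpiP => M /=.
  exact: op_comp_seq.
- move=> I J L a b c ab ac d e1 e2 e3 e4 x y z.
  have [s ->] := rpi_surj x; have [t ->] := rpi_surj y.
  have [u ->] := rpi_surj z; rewrite !piE -rpiZ; apply: rpiP => M /=.
  exact: op_comp_par.
- move=> I a e x; have [t ->] := rpi_surj x.
  by rewrite !piE; apply: rpiP => M /=; rewrite op_unit_r.
- move=> J b e y; have [t ->] := rpi_surj y.
  by rewrite !piE; apply: rpiP => M /=; rewrite op_unit_l.
Defined.

Definition Ram_E : Ram boolF degE := rpi RE.
Definition Ram_L : Ram boolF degL := rpi RL.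
Definition Ram_O : Ram boolF degO := rpi RO.

Lemma gen2_pi d (t : ram_term boolF d) (T : finSet) (i j : T) (h : enum2 i j) :
  gen2 (P := Ram) (rpi t) h = rpi (RMap (Bij h) t).
Proof. exact: ram_map_pi. Qed.

Lemma graft_pi a b c (e : a + b = c) (s : ram_term boolF a)
    (t : ram_term boolF b) (T : finSet) (i j k : T) (h : enum3 i j k) :
  graft (P := Ram) e (rpi s) (rpi t) h =
  rpi (RMap (Bij h) (RComp e (RMap (Bij enum_star) s) t)).
Proof. by rewrite /graft gen2_pi /= ram_comp_pi ram_map_pi. Qed.

Lemma Ram_relations : ram_relations Ram_E Ram_L Ram_O.
Proof.
split=> [T i j h|T i j h|T i j h|T i j k h|T i j k h|T i j k h|T i j k h|T i j k h].
all: rewrite /= /Ram_E /Ram_L /Ram_O ?gen2_pi ?graft_pi.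
- by apply: rpiP => M; apply: (ram_E_sym (rm_rel M)).
- rewrite -scaleN1r -rpiZ; apply: rpiP => M /=; rewrite scaleN1r.
  exact: (ram_L_asym (rm_rel M)).
- rewrite -scaleN1r -rpiZ; apply: rpiP => M /=; rewrite scaleN1r.
  exact: (ram_O_asym (rm_rel M)).
- by apply: rpiP => M; apply: (ram_EE (rm_rel M)).
- rewrite -!rpiD; apply: (rpiP (t := RZero _ _)) => M.
  exact: (ram_LL (rm_rel M)).
- rewrite -!rpiD; apply: (rpiP (t := RZero _ _)) => M.
  exact: (ram_OL (rm_rel M)).
- by rewrite -!rpiD; apply: rpiP => M; apply: (ram_LE (rm_rel M)).
- by rewrite -!rpiD; apply: rpiP => M; apply: (ram_OE (rm_rel M)).
Qed.

Record operad_morph (P Q : operad K) (f : forall I, bgmap (P I) (Q I)) : Prop := {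
  morph_map : forall I J (g : bij I J) d (x : P I d),
    f J d (op_map P g d x) = op_map Q g d (f I d x);
  morph_comp : forall I J a b c (e : a + b = c) (x : P (optF I) a) (y : P J b),
    f (sumF I J) c (op_comp P e x y) = op_comp Q e (f (optF I) a x) (f J b y);
  morph_unit : f unitF 0 (op_unit P) = op_unit Q
}.

Definition ram_lift (M : ram_model) (I : finSet) : bgmap (Ram I) (M I) :=
  fun d => @lev_lin K (ram_premod I d) M.

Lemma ram_lift_pi M I d (t : ram_term I d) :
  ram_lift M I d (rpi t) = ram_eval M t.
Proof. exact: (@lev_pi _ (ram_premod I d) M t). Qed.

Lemma ram_lift_morph M : operad_morph (P := Ram) (ram_lift M).
Proof.
split=> [I J g d x|I J a b c e x y|].
- have [t ->] := rpi_surj x.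
  by rewrite [op_map _ _ _ _]ram_map_pi !ram_lift_pi.
- have [s ->] := rpi_surj x; have [t ->] := rpi_surj y.
  by rewrite [op_comp Ram _ _ _]ram_comp_pi !ram_lift_pi.
- exact: ram_lift_pi.
Qed.

Lemma ram_lift_gen M :
  [/\ ram_lift M boolF degE Ram_E = rm_E M,
      ram_lift M boolF degL Ram_L = rm_L M &
      ram_lift M boolF degO Ram_O = rm_O M].
Proof. by split; apply: ram_lift_pi. Qed.

Lemma ram_lift_unique (M : ram_model) (f : forall I, bgmap (Ram I) (M I)) :
  operad_morph f -> f boolF degE Ram_E = rm_E M ->
  f boolF degL Ram_L = rm_L M -> f boolF degO Ram_O = rm_O M ->
  forall I d (x : Ram I d), f I d x = ram_lift M I d x.
Proof.
move=> [fmap fcomp funit] fE fL fO I d x; have [t ->] := rpi_surj x.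
rewrite ram_lift_pi; elim: t => {I d x} //=.
- by move=> I d; exact: (linear0 (f I d)).
- by move=> I d s <- t <-; rewrite rpiD linearD.
- by move=> I d k t <-; rewrite rpiZ linearZ_LR.
- by move=> I J d g t <-; rewrite -fmap /= ram_map_pi.
- by move=> I J a b c e s <- t <-; rewrite -fcomp /= ram_comp_pi.
Qed.

End Ram.

Record ram_coproduct (K : fieldType)
    (D : forall I, bgcomul (@Ram K I)) : Prop := {
  ram_coproduct_comul : operad_comul D;
  ram_coproduct_E : forall (T : finSet) (i j : T) (h : enum2 i j),
    let E := gen2 (Ram_E K) h in
    D T degE E = pure degEE E E;
  ram_coproduct_L : forall (T : finSet) (i j : T) (h : enum2 i j),
    let E := gen2 (Ram_E K) h in let L := gen2 (Ram_L K) h in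
    D T degL L = pure degEL E L + pure degLE L E;
  ram_coproduct_O : forall (T : finSet) (i j : T) (h : enum2 i j),
    let E := gen2 (Ram_E K) h in let O := gen2 (Ram_O K) h in
    D T degO O = pure degEO E O + pure degOE O E
}.

(* Main.v *)
Require Import Defs.
From HB Require Import structures.
From mathcomp Require Import all_boot all_order all_algebra reals complex.
From mathcomp Require Import boolp ring.
Set Implicit Arguments.
Unset Strict Implicit.
Unset Printing Implicit Defensive.
Import GRing.Theory.
Local Open Scope ring_scope.

Local Notation "V ⊗ W" := (tens V W) (at level 40, left associativity).

(** The operad Ram is initial among operads equipped with elements E, L, Ω
    subject to the relations.  A coproduct compatible with composition is the
    same thing as an operad morphism from Ram to its Hadamard square
    Ram ⊗ Ram, whose value on I is Ram(I) ⊗ Ram(I), composed with the Koszul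
    sign ([hadamard], [operad_comulP]).  So existence and uniqueness of the
    coproduct both reduce to one computation: the elements E⊗E, E⊗L + L⊗E and
    E⊗Ω + Ω⊗E of the Hadamard square satisfy the relations of Ram
    ([square_relations]).

    Write EE, EX, XE for the composites E_{i,⋆} ∘ E_{j,k}, and so on, where X
    is L or Ω.  Since X is antisymmetric, the Leibniz relation reads
    XE(i;j,k) = EX(k;i,j) - EX(j;k,i).  The composite of two primitive elements
    E⊗X + X⊗E and E⊗Y + Y⊗E is the symmetrised product of EE with XY plus the
    symmetrised product of EY with XE ([graft_primitive]).  As EE is invariant
    under rotation, the first parts add up to EE times a Jacobi relation.
    The second parts are symmetrised products of an EY and an EX at two
    different rotations; over a cyclic sum they cancel in pairs
    ([telescope3]).  No Koszul sign appears, because at most one of the two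
    generators in a relation is odd.

    Coassociativity and the counit identities compare two operad morphisms out
    of Ram, so they too need only be checked on generators ([ram_morph_ext]),
    once tensor products of morphisms, the associator and the contraction
    against an augmentation are known to be operad morphisms.  The counit
    is the morphism from Ram to the operad of commutative algebras which sends
    E to the product and L, Ω to zero. *)

(** * Signs and tensors *)

Section Tools.
Variable K : fieldType.
Implicit Types V W : bgspace K.

Lemma ksignDl (a b c : bideg) : ksign K (a + b) c = ksign K a c * ksign K b c.
Proof. by rewrite /ksign mulrDl exprzDr ?unitrN1. Qed.

Lemma ksignDr (a b c : bideg) : ksign K a (b + c) = ksign K a b * ksign K a c.
Proof. by rewrite /ksign mulrDr exprzDr ?unitrN1. Qed.

Lemma ksignC (a b : bideg) : ksign K a b = ksign K b a.
Proof. by rewrite /ksign mulrC. Qed.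

Lemma ksignK (a b : bideg) : ksign K a b * ksign K a b = 1.
Proof. by rewrite /ksign -exprzMl ?unitrN1 // mulrNN mulr1 exp1rz. Qed.

Lemma ksign0l (a : bideg) : ksign K 0 a = 1.
Proof. by rewrite /ksign mul0r. Qed.

Lemma ksign0r (a : bideg) : ksign K a 0 = 1.
Proof. by rewrite ksignC ksign0l. Qed.

(* Linearity stated as a proposition, for the composition maps of an operad and
   for [pure], which are not packaged as linear maps in each argument. *)
Section LinearProp.
Variables (V W : lmodType K) (f : V -> W) (lf : linear f).

Let F : {linear V -> W} := HB.pack f (GRing.isLinear.Build K V W _ f lf).

Lemma lin0 : f 0 = 0. Proof. exact: (linear0 F). Qed.
Lemma linD v w : f (v + w) = f v + f w. Proof. exact: (linearD F). Qed.
Lemma linN v : f (- v) = - f v. Proof. exact: (linearN F). Qed.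
Lemma linZ k v : f (k *: v) = k *: f v. Proof. exact: (linearZ_LR F). Qed.

End LinearProp.

Section Pure.
Variables (V W : bgspace K) (d a b : bideg) (e : a + b = d).

Lemma pureDl v v' w : pure e (v + v' : V a) (w : W b) = pure e v w + pure e v' w.
Proof. exact: linD (pure_linear_l e w) _ _. Qed.
Lemma pureDr v w w' : pure e (v : V a) (w + w' : W b) = pure e v w + pure e v w'.
Proof. exact: linD (pure_linear_r e v) _ _. Qed.
Lemma pureNl v w : pure e (- v : V a) (w : W b) = - pure e v w.
Proof. exact: linN (pure_linear_l e w) _. Qed.
Lemma pureNr v w : pure e (v : V a) (- w : W b) = - pure e v w.
Proof. exact: linN (pure_linear_r e v) _. Qed.
Lemma pure0l w : pure e (0 : V a) (w : W b) = 0.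
Proof. exact: lin0 (pure_linear_l e w). Qed.
Lemma pure0r v : pure e (v : V a) (0 : W b) = 0.
Proof. exact: lin0 (pure_linear_r e v). Qed.
Lemma pureZl k v w : pure e (k *: v : V a) (w : W b) = k *: pure e v w.
Proof. exact: linZ (pure_linear_l e w) _ _. Qed.
Lemma pureZr k v w : pure e (v : V a) (k *: w : W b) = k *: pure e v w.
Proof. exact: linZ (pure_linear_r e v) _ _. Qed.

End Pure.

(** Bidegrees have decidable equality, so a tensor does not depend on the proof
    that the degrees of its factors add up. *)
Lemma pure_irr V W d a b (e e' : a + b = d) (v : V a) (w : W b) :
  pure e v w = pure e' v w.
Proof. by rewrite (eq_irrelevance e e'). Qed.

Lemma tmap_pure V W V' W' (f : bgmap V V') (g : bgmap W W') d a b
  (e : a + b = d) (v : V a) (w : W b) :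
  tmap f g d (pure e v w) = pure e (f a v) (g b w).
Proof. exact: tlift_pure. Qed.

(** Equalities between two expressions linear in a tensor are reduced to pure
    tensors with this form of extensionality, which spares packaging both sides
    as linear maps. *)
Lemma tens_eq V W d (M : lmodType K) (f g : (V ⊗ W) d -> M) :
  linear f -> linear g ->
  (forall a b (e : a + b = d) v w, f (pure e v w) = g (pure e v w)) -> f =1 g.
Proof.
move=> lf lg fg.
pose F : {linear (V ⊗ W) d -> M} := HB.pack f (GRing.isLinear.Build K _ M _ f lf).
pose G : {linear (V ⊗ W) d -> M} := HB.pack g (GRing.isLinear.Build K _ M _ g lg).
exact: (@tens_ext _ _ _ _ _ F G fg).
Qed.

(** The degrees [p], [q], [s], [t] of the intermediate tensors are arbitrary
    names for the sums: without this freedom iterated interchanges would meet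
    degrees such as [a + (b + c)] and [(a + b) + c], which are not
    convertible. *)
Lemma tinter_pure (U V U' V' : bgspace K) a b a' b' p q d (e1 : a + b = p)
  (e2 : a' + b' = q) (e : p + q = d) s t (f1 : a + a' = s) (f2 : b + b' = t)
  (f : s + t = d) (u : U a) (v : V b) (u' : U' a') (v' : V' b') :
  tinter U V U' V' d (pure e (pure e1 u v) (pure e2 u' v')) =
  ksign K b a' *: pure f (pure f1 u u') (pure f2 v v').
Proof.
subst s t; rewrite /tinter tlift_pure.
rewrite [LHS](tlift_pure (tinter_middle U V e _) e1).
rewrite [LHS](tlift_pure (tinter_inner U' V' e e1 u v)).
by congr (_ *: _); apply: pure_irr.
Qed.

Lemma tassoc_pure (U V W : bgspace K) a b c p q d (e1 : a + b = p) (e : p + c = d)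
  (f1 : b + c = q) (f : a + q = d) (u : U a) (v : V b) (w : W c) :
  tassoc U V W d (pure e (pure e1 u v) w) = pure f u (pure f1 v w).
Proof.
subst q; rewrite /tassoc tlift_pure [LHS](tlift_pure (tassoc_inner U V e w)).
exact: pure_irr.
Qed.

Section SymTens.
Variables (V : bgspace K) (a b c : bideg) (e : a + b = c) (e' : b + a = c).

(** The coproducts of L and Ω have this shape, and so do the cross terms in the
    composite of two of them. *)
Definition symtens (u : V a) (v : V b) : (V ⊗ V) c := pure e u v + pure e' v u.

Lemma symtensDr u v v' : symtens u (v + v') = symtens u v + symtens u v'.
Proof. by rewrite /symtens pureDl pureDr addrACA. Qed.

Lemma symtensNr u v : symtens u (- v) = - symtens u v.
Proof. by rewrite /symtens pureNl pureNr opprD. Qed.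

Lemma symtens0r u : symtens u 0 = 0.
Proof. by rewrite /symtens pure0l pure0r addr0. Qed.

End SymTens.

Lemma symtensC V a b c (e : a + b = c) (e' : b + a = c) (u : V a) (v : V b) :
  symtens e e' u v = symtens e' e v u.
Proof. exact: addrC. Qed.

Lemma symtens_irr V a b c (e f : a + b = c) (e' f' : b + a = c) (u : V a) (v : V b) :
  symtens e e' u v = symtens f f' u v.
Proof. by rewrite (eq_irrelevance e f) (eq_irrelevance e' f'). Qed.

End Tools.

(** * The Hadamard product of two operads *)

Section Hadamard.
Variable K : fieldType.

Section Operads.
Variables P Q : operad K.

Definition hobj (I : finSet) : bgspace K := P I ⊗ Q I.

Definition hmap (I J : finSet) (f : bij I J) : bgmap (hobj I) (hobj J) :=
  tmap (op_map P f) (op_map Q f).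

Definition hcomp (I J : finSet) a b c (e : a + b = c) (x : hobj (optF I) a)
    (y : hobj J b) : hobj (sumF I J) c :=
  tmap (op_comp_map P I J) (op_comp_map Q I J) c (tinter _ _ _ _ c (pure e x y)).

Lemma hcomp_linear_l I J a b c (e : a + b = c) (y : hobj J b) :
  linear (fun x : hobj (optF I) a => hcomp e x y).
Proof. by move=> k x x'; rewrite /hcomp pure_linear_l !linearP. Qed.

Lemma hcomp_linear_r I J a b c (e : a + b = c) (x : hobj (optF I) a) :
  linear (fun y : hobj J b => hcomp e x y).
Proof. by move=> k y y'; rewrite /hcomp pure_linear_r !linearP. Qed.

Lemma hmapZ I J (f : bij I J) d k (x : hobj I d) :
  hmap f d (k *: x) = k *: hmap f d x.
Proof. exact: linearZ_LR. Qed.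

Lemma hcompZl I J a b c (e : a + b = c) k (x : hobj (optF I) a) (y : hobj J b) :
  hcomp e (k *: x) y = k *: hcomp e x y.
Proof. exact: linZ (hcomp_linear_l e y) _ _. Qed.

Lemma hcompZr I J a b c (e : a + b = c) k (x : hobj (optF I) a) (y : hobj J b) :
  hcomp e x (k *: y) = k *: hcomp e x y.
Proof. exact: linZ (hcomp_linear_r e x) _ _. Qed.

Lemma hmap_pure I J (f : bij I J) d a b (e : a + b = d) (x : P I a) (y : Q I b) :
  hmap f d (pure e x y) = pure e (op_map P f a x) (op_map Q f b y).
Proof. exact: tmap_pure. Qed.

Lemma hcomp_pure I J a a' b b' s t p q d (e1 : a + a' = s) (e2 : b + b' = t)
    (e : s + t = d) (f1 : a + b = p) (f2 : a' + b' = q) (f : p + q = d)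
    (x : P (optF I) a) (x' : Q (optF I) a') (y : P J b) (y' : Q J b') :
  hcomp e (pure e1 x x') (pure e2 y y') =
  ksign K a' b *: pure f (op_comp P f1 x y) (op_comp Q f2 x' y').
Proof.
rewrite /hcomp (tinter_pure e1 e2 e f1 f2 f) linearZ_LR tmap_pure.
by rewrite /op_comp_map !tlift_pure.
Qed.

Lemma hmap_id I d (x : hobj I d) : hmap (id_bij I) d x = x.
Proof.
move: x; apply: tens_eq => [k x y|k x y|a b e x y]; rewrite ?linearP //.
by rewrite hmap_pure !op_map_id.
Qed.

Lemma hmap_comp I J L (f : bij I J) (g : bij J L) d (x : hobj I d) :
  hmap (comp_bij g f) d x = hmap g d (hmap f d x).
Proof.
move: x; apply: tens_eq => [k x y|k x y|a b e x y]; rewrite ?linearP //.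
by rewrite !hmap_pure !op_map_comp.
Qed.

Let hlinE := (hcomp_linear_l, hcomp_linear_r, linearP).

Lemma hcomp_nat I J I' J' (f : bij I I') (g : bij J J') a b c
    (e : a + b = c) (x : hobj (optF I) a) (y : hobj J b) :
  hcomp e (hmap (omap_bij f) a x) (hmap g b y) =
  hmap (sum_bij f g) c (hcomp e x y).
Proof.
move: x; apply: tens_eq => [k x x'|k x x'|a1 a2 ea x1 x2]; rewrite ?hlinE //.
move: y; apply: tens_eq => [k y y'|k y y'|b1 b2 eb y1 y2]; rewrite ?hlinE //.
have ec : (a1 + b1) + (a2 + b2) = c by rewrite addrACA ea eb.
rewrite !hmap_pure !(hcomp_pure ea eb e erefl erefl ec) hmapZ hmap_pure.
by rewrite !op_comp_nat.
Qed.

(** Both bracketings move [x'] past [y], then [x'] and [y'] past [z], so the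
    signs agree. *)
Lemma hcomp_seq I J L a b c ab bc d (e1 : a + b = ab) (e2 : ab + c = d)
    (e3 : b + c = bc) (e4 : a + bc = d) (x : hobj (optF I) a)
    (y : hobj (optF J) b) (z : hobj L c) :
  hcomp e2 (hmap (star_r_bij I J) ab (hcomp e1 x y)) z =
  hmap (sum_assoc_bij I J L) d (hcomp e4 x (hcomp e3 y z)).
Proof.
move: x; apply: tens_eq => [k x x'|k x x'|a1 a2 ea x1 x2]; rewrite ?hlinE //.
move: y; apply: tens_eq => [k y y'|k y y'|b1 b2 eb y1 y2]; rewrite ?hlinE //.
move: z; apply: tens_eq => [k z z'|k z z'|c1 c2 ec z1 z2]; rewrite ?hlinE //.
have eab : (a1 + b1) + (a2 + b2) = ab by rewrite addrACA ea eb.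
have ebc : (b1 + c1) + (b2 + c2) = bc by rewrite addrACA ec eb.
have ed : (a1 + b1 + c1) + (a2 + b2 + c2) = d by rewrite addrACA ec eab.
rewrite (hcomp_pure ea eb e1 erefl erefl eab) (hcomp_pure eb ec e3 erefl erefl ebc).
rewrite hmapZ hmap_pure hcompZl hcompZr.
rewrite (hcomp_pure eab ec e2 erefl erefl ed).
rewrite (hcomp_pure ea ebc e4 (addrA _ _ _) (addrA _ _ _) ed).
rewrite !hmapZ hmap_pure !scalerA ksignDl ksignDr.
rewrite !(op_comp_seq _ _ erefl (addrA _ _ _)).
by congr (_ *: _); rewrite mulrA mulrC.
Qed.

(** Besides a common sign [|x'|(|y| + |z|)], the left-hand side moves [y'] past
    [z] and the right-hand side moves [z'] past [y].  Together with the signs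
    [|y||z|] and [|y'||z'|] of parallel composition in the two factors, these
    make up [(|y| + |y'|)(|z| + |z'|)]. *)
Lemma hcomp_par I J L a b c ab ac d (e1 : a + b = ab) (e2 : ab + c = d)
    (e3 : a + c = ac) (e4 : ac + b = d) (x : hobj (optF (optF I)) a)
    (y : hobj J b) (z : hobj L c) :
  hmap (sum_swap_r_bij I J L) d
    (hcomp e2 (hmap (star_l_bij I J) ab (hcomp e1 x y)) z) =
  ksign K b c *:
    hcomp e4 (hmap (star_l_bij I L) ac
      (hcomp e3 (hmap (swap_stars_bij I) a x) z)) y.
Proof.
move: x; apply: tens_eq => [k x x'|k x x'|a1 a2 ea x1 x2].
- by rewrite !hlinE.
- by rewrite !hlinE // scalerDr !scalerA mulrC.
move: y; apply: tens_eq => [k y y'|k y y'|b1 b2 eb y1 y2].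
- by rewrite !hlinE.
- by rewrite !hlinE // scalerDr !scalerA mulrC.
move: z; apply: tens_eq => [k z z'|k z z'|c1 c2 ec z1 z2].
- by rewrite !hlinE.
- by rewrite !hlinE // scalerDr !scalerA mulrC.
have eab : (a1 + b1) + (a2 + b2) = ab by rewrite addrACA ea eb.
have eac : (a1 + c1) + (a2 + c2) = ac by rewrite addrACA ec ea.
have ed : (a1 + b1 + c1) + (a2 + b2 + c2) = d by rewrite addrACA ec eab.
rewrite (hcomp_pure ea eb e1 erefl erefl eab) hmap_pure.
rewrite (hcomp_pure ea ec e3 erefl erefl eac).
rewrite !hmapZ !hmap_pure !hcompZl.
rewrite (hcomp_pure eab ec e2 erefl erefl ed).
rewrite (hcomp_pure eac eb e4 (addrAC _ _ _) (addrAC _ _ _) ed).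
rewrite !hmapZ hmap_pure !scalerA.
rewrite !(op_comp_par erefl erefl erefl (addrAC _ _ _)) pureZl pureZr !scalerA.
congr (_ *: _); rewrite -eb -ec !ksignDl !ksignDr.
(* The sign of [y] and [z'] is on the right-hand side twice. *)
rewrite (ksignC K c2 b1) -[LHS]mulr1 -(ksignK K b1 c2); ring.
Qed.

Lemma hcomp_unit_r I a (e : a + 0 = a) (x : hobj (optF I) a) :
  hmap (unit_r_bij I) a
    (hcomp e x (pure (addr0 (0 : bideg)) (op_unit P) (op_unit Q))) = x.
Proof.
move: x; apply: tens_eq => [k x x'|k x x'|a1 a2 ea x1 x2]; rewrite ?hlinE //.
rewrite (hcomp_pure ea (addr0 0) e (addr0 _) (addr0 _) ea) hmapZ.
by rewrite hmap_pure !op_unit_r ksign0r scale1r.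
Qed.

Lemma hcomp_unit_l J b (e : 0 + b = b) (y : hobj J b) :
  hmap (void_l_bij J) b (hcomp e (hmap unit_star_bij 0
      (pure (addr0 (0 : bideg)) (op_unit P) (op_unit Q))) y) = y.
Proof.
move: y; apply: tens_eq => [k y y'|k y y'|b1 b2 eb y1 y2]; rewrite ?hlinE //.
rewrite hmap_pure (hcomp_pure (addr0 0) eb e (add0r _) (add0r _) eb) hmapZ.
by rewrite hmap_pure !op_unit_l ksign0l scale1r.
Qed.

Definition hadamard : operad K :=
  Operad hmap_id hmap_comp hcomp_linear_l hcomp_linear_r hcomp_nat hcomp_seq
    hcomp_par hcomp_unit_r hcomp_unit_l.

End Operads.
End Hadamard.

(** * The relations of Ram in the Hadamard square *)

Section Relations.
Variable K : fieldType.

Section Graft.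
Variable P : operad K.

Lemma gen2_linear d (T : finSet) (i j : T) (h : enum2 i j) :
  linear (fun X : P boolF d => gen2 X h).
Proof. exact: linearP. Qed.

Lemma graft_linear_l a b c (e : a + b = c) (Y : P boolF b) (T : finSet)
    (i j k : T) (h : enum3 i j k) :
  linear (fun X : P boolF a => graft e X Y h).
Proof. by move=> r X X'; rewrite /graft gen2_linear op_comp_linear_l linearP. Qed.

Lemma graft_linear_r a b c (e : a + b = c) (X : P boolF a) (T : finSet)
    (i j k : T) (h : enum3 i j k) :
  linear (fun Y : P boolF b => graft e X Y h).
Proof. by move=> r Y Y'; rewrite /graft op_comp_linear_r linearP. Qed.

Lemma graft0l a b c (e : a + b = c) (Y : P boolF b) (T : finSet)
    (i j k : T) (h : enum3 i j k) : graft e 0 Y h = 0.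
Proof. exact: lin0 (graft_linear_l e Y h). Qed.

Lemma graft0r a b c (e : a + b = c) (X : P boolF a) (T : finSet)
    (i j k : T) (h : enum3 i j k) : graft e X 0 h = 0.
Proof. exact: lin0 (graft_linear_r e X h). Qed.

Lemma graft_irr a b c (e e' : a + b = c) (X : P boolF a) (Y : P boolF b)
    (T : finSet) (i j k : T) (h h' : enum3 i j k) :
  graft e X Y h = graft e' X Y h'.
Proof. by rewrite (eq_irrelevance e e') (Prop_irrelevance h h'). Qed.

Lemma enum2_bool : @enum2 boolF false true.
Proof. by exists id => -[]. Qed.

Lemma gen2_bool d (X : P boolF d) (h : enum2 (T := boolF) false true) :
  gen2 X h = X.
Proof.
have e : Bij h = id_bij boolF by apply: Defs.bij_eq => -[].
by rewrite /gen2 e op_map_id.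
Qed.

(** Equivariance of composition in its second argument: exchanging [j] and [k]
    amounts to exchanging the two inputs of [Y]. *)
Lemma graft_flip a b c (e : a + b = c) (X : P boolF a) (Y : P boolF b)
    (T : finSet) (i j k : T) (h : enum3 i j k) (h' : enum3 i k j) :
  graft e X Y h' = graft e X (gen2 Y (enum2C enum2_bool)) h.
Proof.
rewrite /graft -[gen2 X enum_star]op_map_id.
have idE : omap_bij (id_bij unitF) = id_bij (optF unitF).
  by apply: Defs.bij_eq => -[[]|].
rewrite -idE [in RHS]/gen2.
rewrite op_comp_nat -op_map_comp.
have -> : comp_bij (Bij h) (sum_bij (id_bij unitF) (Bij (enum2C enum2_bool)))
    = Bij h' by apply: Defs.bij_eq => -[[]|[]].
by rewrite idE op_map_id.
Qed.

End Graft.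

Section HadamardGraft.
Variables P Q : operad K.

Lemma gen2_pure d a b (e : a + b = d) (X : P boolF a) (X' : Q boolF b)
    (T : finSet) (i j : T) (h : enum2 i j) :
  gen2 (P := hadamard P Q) (pure e X X') h = pure e (gen2 X h) (gen2 X' h).
Proof. exact: hmap_pure. Qed.

Lemma graft_pure a a' b b' s t p q d (e1 : a + a' = s) (e2 : b + b' = t)
    (e : s + t = d) (f1 : a + b = p) (f2 : a' + b' = q) (f : p + q = d)
    (X : P boolF a) (X' : Q boolF a') (Y : P boolF b) (Y' : Q boolF b')
    (T : finSet) (i j k : T) (h : enum3 i j k) :
  graft (P := hadamard P Q) e (pure e1 X X') (pure e2 Y Y') h =
  ksign K a' b *: pure f (graft f1 X Y h) (graft f2 X' Y' h).
Proof.
rewrite /graft gen2_pure [op_comp _ _ _ _](hcomp_pure e1 e2 e f1 f2 f).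
by rewrite [LHS]hmapZ hmap_pure.
Qed.

End HadamardGraft.

Section Square.
Variables (P : operad K) (E : P boolF degE) (L : P boolF degL) (O : P boolF degO).
Hypothesis rel : ram_relations E L O.

(** What L and Ω have in common: an antisymmetric bracket, of any bidegree,
    which acts on the product E by derivations. *)
Record derivation_bracket d (X : P boolF d) : Prop := {
  bracket_asym : forall (T : finSet) (i j : T) (h : enum2 i j),
    gen2 X (enum2C h) = - gen2 X h;
  bracket_leibniz : forall (T : finSet) (i j k : T) (h : enum3 i j k),
    graft (addr0 d) X E h =
      graft (add0r d) E X (enum3_swap h) +
      graft (add0r d) E X (enum3_rot (enum3_rot h))
}.

Lemma bracket_L : derivation_bracket L.
Proof.
split=> [|T i j k h]; first exact: (ram_L_asym rel).
rewrite (graft_irr _ degLE _ _ _ h) (ram_LE rel).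
by congr (_ + _); apply: graft_irr.
Qed.

Lemma bracket_O : derivation_bracket O.
Proof.
split=> [|T i j k h]; first exact: (ram_O_asym rel).
rewrite (graft_irr _ degOE _ _ _ h) (ram_OE rel).
by congr (_ + _); apply: graft_irr.
Qed.

Definition grouplike : hadamard P P boolF degE := pure degEE E E.

Definition primitive d (X : P boolF d) : hadamard P P boolF d :=
  symtens (add0r d) (addr0 d) E X.

Lemma gen2_primitive d (X : P boolF d) (T : finSet) (i j : T) (h : enum2 i j) :
  gen2 (primitive X) h = symtens (add0r d) (addr0 d) (gen2 E h) (gen2 X h).
Proof. by rewrite (linD (gen2_linear (P := hadamard P P) h)) !gen2_pure. Qed.

Lemma grouplike_sym (T : finSet) (i j : T) (h : enum2 i j) :
  gen2 grouplike (enum2C h) = gen2 grouplike h.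
Proof. by rewrite !gen2_pure (ram_E_sym rel). Qed.

Lemma primitive_asym d (X : P boolF d) :
  derivation_bracket X -> forall (T : finSet) (i j : T) (h : enum2 i j),
  gen2 (primitive X) (enum2C h) = - gen2 (primitive X) h.
Proof.
by move=> dX T i j h; rewrite !gen2_primitive (ram_E_sym rel) (bracket_asym dX) symtensNr.
Qed.

Definition graft_EE (T : finSet) (i j k : T) (h : enum3 i j k) :=
  graft degEE E E h.
Definition graft_EX d (X : P boolF d) (T : finSet) (i j k : T)
  (h : enum3 i j k) := graft (add0r d) E X h.

Lemma graft_EE_rot (T : finSet) (i j k : T) (h : enum3 i j k) :
  graft_EE (enum3_rot h) = graft_EE h.
Proof. by rewrite /graft_EE -(ram_EE rel). Qed.

Lemma graft_EE_swap (T : finSet) (i j k : T) (h : enum3 i j k) :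
  graft_EE (enum3_swap h) = graft_EE h.
Proof.
rewrite -[RHS]graft_EE_rot /graft_EE (graft_flip _ _ _ (enum3_rot h)).
by rewrite (ram_E_sym rel) gen2_bool.
Qed.

Lemma graft_EX_swap d (X : P boolF d) (T : finSet) (i j k : T)
    (h : enum3 i j k) :
  derivation_bracket X ->
  graft_EX X (enum3_swap h) = - graft_EX X (enum3_rot h).
Proof.
move=> dX; rewrite /graft_EX (graft_flip _ _ _ (enum3_rot h)) (bracket_asym dX).
by rewrite gen2_bool (linN (graft_linear_r _ _ _)).
Qed.

Lemma graft_EX_rot3 d (X : P boolF d) (T : finSet) (i j k : T)
    (h : enum3 i j k) :
  graft_EX X (enum3_rot (enum3_rot (enum3_rot h))) = graft_EX X h.
Proof. exact: graft_irr. Qed.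

(** The Leibniz relation with only rotations on the right-hand side, the form in
    which cyclic sums can be compared term by term. *)
Lemma graft_XE d (X : P boolF d) (T : finSet) (i j k : T) (h : enum3 i j k) :
  derivation_bracket X ->
  graft (addr0 d) X E h =
  graft_EX X (enum3_rot (enum3_rot h)) - graft_EX X (enum3_rot h).
Proof. by move=> dX; rewrite (bracket_leibniz dX) addrC -graft_EX_swap. Qed.

Lemma graft_grouplike (T : finSet) (i j k : T) (h : enum3 i j k) :
  graft degEE grouplike grouplike h = pure degEE (graft_EE h) (graft_EE h).
Proof.
by rewrite (graft_pure _ _ degEE degEE degEE degEE) ksign0r scale1r.
Qed.

Lemma primitive_leibniz d (X : P boolF d) (e1 : d + degE = d)
    (e2 : degE + d = d) (T : finSet) (i j k : T) (h : enum3 i j k) :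
  derivation_bracket X ->
  graft e1 (primitive X) grouplike h =
    graft e2 grouplike (primitive X) (enum3_swap h) +
    graft e2 grouplike (primitive X) (enum3_rot (enum3_rot h)).
Proof.
move=> dX.
have EX (t u v : T) (g : enum3 t u v) : graft e2 grouplike (primitive X) g =
    symtens (add0r d) (addr0 d) (graft_EE g) (graft_EX X g).
  rewrite (linD (graft_linear_r e2 _ g)) (graft_pure _ _ _ degEE (add0r d) (add0r d)).
  by rewrite (graft_pure _ _ _ (add0r d) degEE (addr0 d)) !ksign0l !scale1r.
have XE : graft e1 (primitive X) grouplike h =
    symtens (add0r d) (addr0 d) (graft_EE h) (graft (addr0 d) X E h).
  rewrite (linD (graft_linear_l e1 _ h)) (graft_pure _ _ _ degEE (addr0 d) (add0r d)).
  by rewrite (graft_pure _ _ _ (addr0 d) degEE (addr0 d)) !ksign0r !scale1r.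
by rewrite XE !EX (bracket_leibniz dX) graft_EE_swap !graft_EE_rot symtensDr.
Qed.

(** Of the four products, [(E⊗X)∘(E⊗Y)] and [(X⊗E)∘(Y⊗E)] make up the first
    summand, the mixed ones the second.  Only [(E⊗X)∘(Y⊗E)] carries a sign,
    that of [x] and [y]. *)
Lemma graft_primitive x y z (e : x + y = z) (e' : y + x = z)
    (X : P boolF x) (Y : P boolF y) (T : finSet) (i j k : T) (h : enum3 i j k) :
  derivation_bracket X -> ksign K x y = 1 ->
  graft e (primitive X) (primitive Y) h =
  symtens (add0r z) (addr0 z) (graft_EE h) (graft e X Y h) +
  (symtens e' e (graft_EX Y h) (graft_EX X (enum3_rot (enum3_rot h))) -
   symtens e' e (graft_EX Y h) (graft_EX X (enum3_rot h))).
Proof.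
move=> dX sxy.
rewrite (linD (graft_linear_l e _ h)) !(linD (graft_linear_r e _ h)).
rewrite (graft_pure _ _ _ degEE e (add0r z)).
rewrite (graft_pure _ _ _ (add0r y) (addr0 x) e').
rewrite (graft_pure _ _ _ (addr0 x) (add0r y) e).
rewrite (graft_pure _ _ _ e degEE (addr0 z)).
rewrite sxy !ksign0l ksign0r !scale1r -symtensNr -symtensDr -graft_XE //.
by rewrite /symtens -!addrA; congr (_ + _); rewrite addrC -addrA addrC addrA.
Qed.

Lemma telescope3 (V : zmodType) (o1 o2 o3 u v w : V) :
  o1 + (u - w) + (o2 + (w - v)) + (o3 + (v - u)) = o1 + o2 + o3.
Proof.
by rewrite (addrACA o1) subrKA (addrACA (o1 + o2)) subrKA subrr addr0.
Qed.

(** The mixed terms pair the EL at two different rotations, each unordered pair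
    occurring twice with opposite signs. *)
Lemma primitive_LL (T : finSet) (i j k : T) (h : enum3 i j k) :
  let LL (i j k : T) (h : enum3 i j k) :=
    graft erefl (primitive L) (primitive L) h in
  LL _ _ _ h + LL _ _ _ (enum3_rot h) + LL _ _ _ (enum3_rot (enum3_rot h)) = 0.
Proof.
have dL := bracket_L => /=.
rewrite !(graft_primitive _ erefl) ?ksign0l // !graft_EX_rot3 !graft_EE_rot.
(* Put the two rotations of each pair in the same order. *)
rewrite [symtens _ _ (graft_EX L (enum3_rot h)) (graft_EX L h)]symtensC.
rewrite [symtens _ _ (graft_EX L (enum3_rot (enum3_rot h))) (graft_EX L h)]symtensC.
rewrite [symtens _ _ (graft_EX L (enum3_rot (enum3_rot h)))
           (graft_EX L (enum3_rot h))]symtensC.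
by rewrite telescope3 -!symtensDr (ram_LL rel) symtens0r.
Qed.

(** Here a mixed term pairs an EL with an EΩ.  The terms of the two orders of
    composition, LΩ and ΩL, have to be added before the cyclic sum: their sum
    is again antisymmetric in the two rotations. *)
Lemma primitive_OL (T : finSet) (i j k : T) (h : enum3 i j k) :
  let OL_LO (i j k : T) (h : enum3 i j k) :=
    graft erefl (primitive O) (primitive L) h +
    graft degLO (primitive L) (primitive O) h in
  OL_LO _ _ _ h + OL_LO _ _ _ (enum3_rot h)
    + OL_LO _ _ _ (enum3_rot (enum3_rot h)) = 0.
Proof.
have dL := bracket_L; have dO := bracket_O => /=.
have OL_LO (t u v : T) (g : enum3 t u v) :
    let m a b := symtens degLO erefl a b in
    let eL := graft_EX L in let eO := graft_EX O in
    let g2 := enum3_rot g in let g3 := enum3_rot g2 in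
    graft erefl (primitive O) (primitive L) g +
    graft degLO (primitive L) (primitive O) g =
    symtens (add0r _) (addr0 _) (graft_EE g)
      (graft erefl O L g + graft degLO L O g) +
    ((m (eL _ _ _ _ g) (eO _ _ _ _ g3) + m (eL _ _ _ _ g3) (eO _ _ _ _ g)) -
     (m (eL _ _ _ _ g) (eO _ _ _ _ g2) + m (eL _ _ _ _ g2) (eO _ _ _ _ g))).
  rewrite /= (graft_primitive erefl degLO) // (graft_primitive degLO erefl) //.
  rewrite addrACA symtensDr !(symtensC erefl degLO); congr (_ + _).
  by rewrite addrACA -opprD.
rewrite !OL_LO !graft_EX_rot3 !graft_EE_rot.
(* Order the summands so that equal ones become syntactically equal. *)
rewrite (addrC (symtens _ _ (graft_EX L h) (graft_EX O (enum3_rot h)))).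
rewrite (addrC (symtens _ _ (graft_EX L h) (graft_EX O (enum3_rot (enum3_rot h))))).
rewrite (addrC (symtens _ _ (graft_EX L (enum3_rot h))
                  (graft_EX O (enum3_rot (enum3_rot h))))).
by rewrite telescope3 -!symtensDr (ram_OL rel) symtens0r.
Qed.

Lemma square_relations : ram_relations grouplike (primitive L) (primitive O).
Proof.
have dL := bracket_L; have dO := bracket_O.
split=> [T i j h|T i j h|T i j h|T i j k h|T i j k h|T i j k h|T i j k h|T i j k h].
- exact: grouplike_sym.
- exact: primitive_asym.
- exact: primitive_asym.
- by rewrite !graft_grouplike graft_EE_rot.
- exact: primitive_LL.
- exact: primitive_OL.
- exact: primitive_leibniz.
- exact: primitive_leibniz.
Qed.

End Square.
End Relations.

(** * Operad morphisms *)

Section Morphisms.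
Variable K : fieldType.

Definition bgcomp (U V W : bgspace K) (g : bgmap V W) (f : bgmap U V) :
  bgmap U W := fun d => (g d \o f d)%FUN.

Lemma bgcompE (U V W : bgspace K) (g : bgmap V W) (f : bgmap U V) d x :
  bgcomp g f d x = g d (f d x).
Proof. by []. Qed.

Lemma bgidE (V : bgspace K) d x : bgid V d x = x.
Proof. by []. Qed.

Lemma operad_morph_id (P : operad K) :
  operad_morph (P := P) (Q := P) (fun I => bgid (P I)).
Proof. by []. Qed.

Lemma operad_morph_comp (P Q T : operad K) (g : forall I, bgmap (Q I) (T I))
    (f : forall I, bgmap (P I) (Q I)) :
  operad_morph g -> operad_morph f -> operad_morph (fun I => bgcomp (g I) (f I)).
Proof.
move=> [gm gc gu] [fm fc fu].
by split=> *; rewrite /= ?fm ?fc ?fu ?gm ?gc ?gu.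
Qed.

Lemma operad_morph_tmap (P P' Q Q' : operad K) (f : forall I, bgmap (P I) (P' I))
    (g : forall I, bgmap (Q I) (Q' I)) :
  operad_morph f -> operad_morph g ->
  operad_morph (P := hadamard P Q) (Q := hadamard P' Q')
    (fun I => tmap (f I) (g I)).
Proof.
move=> [fm fc fu] [gm gc gu]; split=> [I J s d x|I J a b c e x y|].
- move: x; apply: tens_eq => [k x y|k x y|a b e x y]; rewrite ?linearP //.
  by rewrite [op_map _ _ _ _]hmap_pure !tmap_pure fm gm.
- move: x; apply: tens_eq => [k x x'|k x x'|a1 a2 ea x1 x2].
  + by rewrite [op_comp _ _ _ _]hcomp_linear_l linearP.
  + by rewrite linearP [LHS]hcomp_linear_l.
  move: y; apply: tens_eq => [k y y'|k y y'|b1 b2 eb y1 y2].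
  + by rewrite [op_comp _ _ _ _]hcomp_linear_r linearP.
  + by rewrite linearP [LHS]hcomp_linear_r.
  have ec : (a1 + b1) + (a2 + b2) = c by rewrite addrACA ea eb.
  rewrite [op_comp _ _ _ _](hcomp_pure ea eb e erefl erefl ec) linearZ_LR.
  rewrite !tmap_pure [RHS](hcomp_pure ea eb e erefl erefl ec).
  by rewrite fc gc.
- by rewrite [LHS]tmap_pure fu gu.
Qed.

(** For either bracketing, composing [x1 ⊗ x2 ⊗ x3] with [y1 ⊗ y2 ⊗ y3] moves
    [x2] past [y1] and [x3] past [y1] and [y2], so the signs agree. *)
Lemma operad_morph_tassoc (P Q T : operad K) :
  operad_morph (P := hadamard (hadamard P Q) T) (Q := hadamard P (hadamard Q T))
    (fun I => tassoc (P I) (Q I) (T I)).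
Proof.
split=> [I J s d x|I J a b c e x y|].
- move: x; apply: tens_eq => [k x x'|k x x'|p c e x w]; rewrite ?linearP //.
  move: x; apply: tens_eq => [k x x'|k x x'|a b e' u v].
  + by rewrite pure_linear_l !linearP.
  + by rewrite pure_linear_l !linearP.
  have f : a + (b + c) = d by rewrite addrA e' e.
  rewrite [op_map _ _ _ _]hmap_pure [op_map _ _ _ _]hmap_pure.
  rewrite !(tassoc_pure e' e erefl f).
  by rewrite [RHS]hmap_pure [op_map (hadamard Q T) _ _ _]hmap_pure.
- move: x; apply: tens_eq => [k x x'|k x x'|p a3 ea x x3].
  + by rewrite [op_comp _ _ _ _]hcomp_linear_l linearP.
  + by rewrite linearP [LHS]hcomp_linear_l.
  move: x; apply: tens_eq => [k x x'|k x x'|a1 a2 ea' x1 x2].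
  + by rewrite pure_linear_l [op_comp _ _ _ _]hcomp_linear_l linearP.
  + by rewrite pure_linear_l linearP [LHS]hcomp_linear_l.
  move: y; apply: tens_eq => [k y y'|k y y'|q b3 eb y y3].
  + by rewrite [op_comp _ _ _ _]hcomp_linear_r linearP.
  + by rewrite linearP [LHS]hcomp_linear_r.
  move: y; apply: tens_eq => [k y y'|k y y'|b1 b2 eb' y1 y2].
  + by rewrite pure_linear_l [op_comp _ _ _ _]hcomp_linear_r linearP.
  + by rewrite pure_linear_l linearP [LHS]hcomp_linear_r.
  have fa : a1 + (a2 + a3) = a by rewrite addrA ea' ea.
  have fb : b1 + (b2 + b3) = b by rewrite addrA eb' eb.
  have epq : (a1 + b1) + (a2 + b2) = p + q by rewrite addrACA ea' eb'.
  have ec : (p + q) + (a3 + b3) = c by rewrite addrACA ea eb.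
  have e23 : (a2 + b2) + (a3 + b3) = (a2 + a3) + (b2 + b3) by rewrite addrACA.
  have fc : (a1 + b1) + ((a2 + a3) + (b2 + b3)) = c by rewrite -e23 addrA epq.
  rewrite [op_comp _ _ _ _](hcomp_pure ea eb e erefl erefl ec).
  rewrite [op_comp (hadamard P Q) _ _ _](hcomp_pure ea' eb' erefl erefl erefl epq).
  rewrite pureZl scalerA linearZ_LR (tassoc_pure epq ec e23 fc).
  rewrite !(tassoc_pure ea' ea erefl fa) !(tassoc_pure eb' eb erefl fb).
  rewrite [RHS](hcomp_pure fa fb e erefl erefl fc).
  rewrite [op_comp (hadamard Q T) _ _ _](hcomp_pure erefl erefl erefl erefl erefl e23).
  by rewrite pureZr !scalerA -eb' ksignDr ksignDl; congr (_ *: _); ring.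
- rewrite [LHS](tassoc_pure _ _ (addr0 (0 : bideg)) (addr0 (0 : bideg))).
  by [].
Qed.

(** Unlike [ram_lift_unique], this compares morphisms whose target has not been
    shown to satisfy the relations of Ram. *)
Lemma ram_morph_ext (P : operad K) (f g : forall I, bgmap (Ram K I) (P I)) :
  operad_morph f -> operad_morph g ->
  f boolF degE (Ram_E K) = g boolF degE (Ram_E K) ->
  f boolF degL (Ram_L K) = g boolF degL (Ram_L K) ->
  f boolF degO (Ram_O K) = g boolF degO (Ram_O K) ->
  forall I d (x : Ram K I d), f I d x = g I d x.
Proof.
move=> [fm fc fu] [gm gc gu] fE fL fO I d x; have [t ->] := rpi_surj x.
elim: t => {I d x} //=.
- by move=> I d; rewrite (linear0 (f I d)) (linear0 (g I d)).
- by move=> I d s hs t ht; rewrite rpiD !linearD hs ht.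
- by move=> I d k t ht; rewrite rpiZ !linearZ_LR ht.
- by rewrite [LHS]fu [RHS]gu.
- by move=> I J d s t ht; rewrite -ram_map_pi [LHS]fm [RHS]gm ht.
- by move=> I J a b c e s hs t ht; rewrite -ram_comp_pi [LHS]fc [RHS]gc hs ht.
Qed.

(** The composition of [hadamard] is the one that makes compatibility of a
    coproduct with composition a morphism condition. *)
Lemma operad_comulP (P : operad K) (D : forall I, bgcomul (P I)) :
  operad_comul D <-> operad_morph (P := P) (Q := hadamard P P) D.
Proof.
have DD I J c a b (e : a + b = c) (x : P (optF I) a) (y : P J b) :
    tmap (op_comp_map P I J) (op_comp_map P I J) c
      (tens_comul (D (optF I)) (D J) c (pure e x y)) =
    op_comp (hadamard P P) e (D (optF I) a x) (D J b y).
  by congr (tmap _ _ _ (tinter _ _ _ _ _ _)); apply: tmap_pure.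
split=> [[Dm Dc Du]|[Dm Dc Du]]; split=> //.
- move=> I J a b c e x y; rewrite -DD -Dc.
  by congr (D _ _ _); rewrite /op_comp_map tlift_pure.
- move=> I J c; apply: tens_eq => [k x y|k x y|a b e x y].
  + by rewrite !linearP.
  + by rewrite !linearP.
  by rewrite DD -Dc /op_comp_map tlift_pure.
Qed.

Lemma bgcast_id (V : bgspace K) d (v : V d) : bgcast d v = v.
Proof. by rewrite /bgcast; case: eqP => // e; rewrite (eq_irrelevance e erefl). Qed.

Lemma contract_l_pure (V W : bgspace K) (f : bgform V) d a b (e : a + b = d)
    (v : V a) (w : W b) :
  contract_l W f d (pure e v w) = f a v *: bgcast d w.
Proof. exact: tlift_pure. Qed.

Lemma contract_r_pure (V W : bgspace K) (f : bgform W) d a b (e : a + b = d)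
    (v : V a) (w : W b) :
  contract_r V f d (pure e v w) = f b w *: bgcast d v.
Proof. exact: tlift_pure. Qed.

Lemma bgcast_map (P : operad K) I J (s : bij I J) b d (x : P I b) :
  op_map P s d (bgcast d x) = bgcast d (op_map P s b x).
Proof.
rewrite /bgcast; case: eqP => [e|_]; last exact: linear0.
by case: d / e.
Qed.

Lemma bgcast_comp (P : operad K) I J a a' b b' c (e : a + b = c)
    (x : P (optF I) a') (y : P J b') :
  a' = a -> b' = b ->
  op_comp P e (bgcast a x) (bgcast b y) =
  bgcast c (op_comp P (erefl (a' + b')) x y).
Proof.
by move=> ea eb; subst a b c; rewrite !bgcast_id.
Qed.

(** A morphism to the operad of commutative algebras, seen as a family of
    functionals. *)
Record augmentation (P : operad K) (eps : forall I, bgform (P I)) : Prop := {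
  aug_degree0 : forall I, degree0 (eps I);
  aug_map : forall I J (s : bij I J) d x, eps J d (op_map P s d x) = eps I d x;
  aug_comp : forall I J a b c (e : a + b = c) (x : P (optF I) a) (y : P J b),
    eps (sumF I J) c (op_comp P e x y) = (eps (optF I) a x : K) * (eps J b y : K);
  aug_unit : eps unitF 0 (op_unit P) = 1
}.

(** A factor on which the augmentation does not vanish has bidegree zero, so the
    Koszul sign of the Hadamard composition is trivial wherever it matters. *)
Lemma operad_morph_contract_l (P Q : operad K) (eps : forall I, bgform (P I)) :
  augmentation eps ->
  operad_morph (P := hadamard P Q) (Q := Q) (fun I => contract_l (Q I) (eps I)).
Proof.
move=> [e0 em ec eu]; split=> [I J s d x|I J a b c e x y|].
- move: x; apply: tens_eq => [k x y|k x y|a b e x y]; rewrite ?linearP //.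
  rewrite [op_map _ _ _ _]hmap_pure !contract_l_pure em linearZ_LR.
  by rewrite bgcast_map.
- move: x; apply: tens_eq => [k x x'|k x x'|a1 a2 ea x1 x2].
  + by rewrite [op_comp _ _ _ _]hcomp_linear_l linearP.
  + by rewrite linearP op_comp_linear_l.
  move: y; apply: tens_eq => [k y y'|k y y'|b1 b2 eb y1 y2].
  + by rewrite [op_comp _ _ _ _]hcomp_linear_r linearP.
  + by rewrite linearP op_comp_linear_r.
  have f : (a1 + b1) + (a2 + b2) = c by rewrite addrACA ea eb.
  rewrite [op_comp _ _ _ _](hcomp_pure ea eb e erefl erefl f) linearZ_LR.
  rewrite !contract_l_pure ec (linZ (op_comp_linear_l e _)).
  rewrite (linZ (op_comp_linear_r e _)) !scalerA.
  have [a0|a0] := eqVneq a1 0; last first.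
    by rewrite (e0 _ _ x1 a0) !(mul0r, mulr0, scale0r).
  have [b0|b0] := eqVneq b1 0; last first.
    by rewrite (e0 _ _ y1 b0) !(mul0r, mulr0, scale0r).
  subst a1 b1; rewrite ksign0r mul1r.
  by rewrite (bgcast_comp e) -?ea -?eb ?add0r.
- by rewrite [LHS]contract_l_pure eu scale1r bgcast_id.
Qed.

Lemma operad_morph_contract_r (P Q : operad K) (eps : forall I, bgform (Q I)) :
  augmentation eps ->
  operad_morph (P := hadamard P Q) (Q := P) (fun I => contract_r (P I) (eps I)).
Proof.
move=> [e0 em ec eu]; split=> [I J s d x|I J a b c e x y|].
- move: x; apply: tens_eq => [k x y|k x y|a b e x y]; rewrite ?linearP //.
  rewrite [op_map _ _ _ _]hmap_pure !contract_r_pure em linearZ_LR.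
  by rewrite bgcast_map.
- move: x; apply: tens_eq => [k x x'|k x x'|a1 a2 ea x1 x2].
  + by rewrite [op_comp _ _ _ _]hcomp_linear_l linearP.
  + by rewrite linearP op_comp_linear_l.
  move: y; apply: tens_eq => [k y y'|k y y'|b1 b2 eb y1 y2].
  + by rewrite [op_comp _ _ _ _]hcomp_linear_r linearP.
  + by rewrite linearP op_comp_linear_r.
  have f : (a1 + b1) + (a2 + b2) = c by rewrite addrACA ea eb.
  rewrite [op_comp _ _ _ _](hcomp_pure ea eb e erefl erefl f) linearZ_LR.
  rewrite !contract_r_pure ec (linZ (op_comp_linear_l e _)).
  rewrite (linZ (op_comp_linear_r e _)) !scalerA.
  have [a0|a0] := eqVneq a2 0; last first.
    by rewrite (e0 _ _ x2 a0) !(mul0r, mulr0, scale0r).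
  have [b0|b0] := eqVneq b2 0; last first.
    by rewrite (e0 _ _ y2 b0) !(mul0r, mulr0, scale0r).
  subst a2 b2; rewrite ksign0l mul1r.
  by rewrite (bgcast_comp e) -?ea -?eb ?addr0.
- by rewrite [LHS]contract_r_pure eu scale1r bgcast_id.
Qed.

End Morphisms.

(** * The operad of commutative algebras *)

Section Com.
Variable K : fieldType.

(** K in bidegree zero and the zero space elsewhere, as row vectors of length 1
    or 0: this gives one type of vectors for all bidegrees. *)
Definition com_obj (I : finSet) : bgspace K := fun d => 'rV[K]_(d == 0).

(** The identification of the bidegree zero part with K, extended by zero. *)
Definition total (d : bideg) (v : 'rV[K]_(d == 0)) : K := \sum_j v 0 j.

Lemma total_linear d : linear (@total d : _ -> K^o).
Proof.
move=> k u v; rewrite /total scaler_sumr -big_split.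
by apply: eq_bigr => j _; rewrite !mxE.
Qed.
HB.instance Definition _ d :=
  GRing.isLinear.Build K 'rV[K]_(d == 0) K^o _ (@total d) (@total_linear d).

Lemma totalP d k (u v : 'rV[K]_(d == 0)) : total (k *: u + v) = k * total u + total v.
Proof. exact: total_linear. Qed.

Lemma total0 d : @total d 0 = 0.
Proof. exact: linear0. Qed.

Lemma total_inj d : injective (@total d).
Proof.
rewrite /total; case: (d == 0) => u v; last by move=> _; apply/rowP => -[].
by rewrite !big_ord1 => uv; apply/rowP => j; rewrite ord1.
Qed.

Lemma total_const d k : total (const_mx k : 'rV[K]_(d == 0)) = k *+ (d == 0).
Proof.
rewrite /total (eq_bigr (fun=> k)) => [|j _]; last by rewrite mxE.
by rewrite sumr_const card_ord.
Qed.

Lemma total_eq0 d (v : 'rV[K]_(d == 0)) : d != 0 -> total v = 0.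
Proof. by rewrite /total; case: (d == 0) v => // v _; rewrite big_ord0. Qed.

Definition com_comp (I J : finSet) a b c (e : a + b = c)
    (x : com_obj (optF I) a) (y : com_obj J b) : com_obj (sumF I J) c :=
  const_mx (total x * total y).

Lemma total_com_comp I J a b c (e : a + b = c) (x : com_obj (optF I) a)
  (y : com_obj J b) : total (com_comp e x y) = total x * total y.
Proof.
rewrite total_const; case: eqP => // c0; rewrite mulr0n.
have [a0|a0] := eqVneq a 0; last by rewrite (total_eq0 x a0) mul0r.
have [b0|b0] := eqVneq b 0; last by rewrite (total_eq0 y b0) mulr0.
by case: c0; rewrite -e a0 b0 addr0.
Qed.

Definition com : operad K.
Proof.
apply: (@Operad K com_obj (fun I J _ => bgid (com_obj I)) com_comp (const_mx 1)).
- by [].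
- by [].
- move=> I J a b c e y k x x'; apply: total_inj.
  by rewrite totalP !total_com_comp totalP mulrDl -mulrA.
- move=> I J a b c e x k y y'; apply: total_inj.
  by rewrite totalP !total_com_comp totalP mulrDr mulrCA.
- by [].
- move=> I J L a b c ab bc d e1 e2 e3 e4 x y z; apply: total_inj.
  by rewrite /= !total_com_comp mulrA.
- move=> I J L a b c ab ac d e1 e2 e3 e4 x y z; apply: total_inj.
  rewrite linearZ_LR /= !total_com_comp mulrAC.
  have [c0|c0] := eqVneq c 0.
    by have -> : ksign K b c = 1 by [rewrite c0 ksign0r]; rewrite scale1r.
  by rewrite (total_eq0 z c0) !(mulr0, mul0r) scaler0.
- move=> I a e x; apply: total_inj.
  by rewrite /= total_com_comp total_const eqxx mulr1.
- move=> J b e y; apply: total_inj.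
  by rewrite /= total_com_comp total_const eqxx mul1r.
Defined.

Lemma com_relations :
  ram_relations (P := com) (const_mx 1 : 'rV_(degE == 0)) 0 0.
Proof.
have opp0 I d : (0 : com I d) = - 0 by rewrite oppr0.
split=> [T i j h|T i j h|T i j h|T i j k h|T i j k h|T i j k h|T i j k h|T i j k h].
- by [].
- exact: opp0.
- exact: opp0.
- by [].
- by move=> LL; rewrite /LL !graft0l !addr0.
- by move=> OL_LO; rewrite /OL_LO !graft0l !addr0.
- by rewrite !graft0l !graft0r addr0.
- by rewrite !graft0l !graft0r addr0.
Qed.

Definition com_model : ram_model K := RamModel com_relations.

End Com.

(** * The Hopf operad Ram *)

Section RamHopf.
Variable K : fieldType.

Definition ram_square : ram_model K := RamModel (square_relations (Ram_relations K)).

Definition ram_comul : forall I, bgcomul (Ram K I) := ram_lift ram_square.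

Lemma ram_comul_morph :
  operad_morph (P := Ram K) (Q := hadamard (Ram K) (Ram K)) ram_comul.
Proof. exact: (ram_lift_morph ram_square). Qed.

Lemma ram_comul_gen :
  [/\ ram_comul boolF degE (Ram_E K) = grouplike (Ram_E K),
      ram_comul boolF degL (Ram_L K) = primitive (Ram_E K) (Ram_L K) &
      ram_comul boolF degO (Ram_O K) = primitive (Ram_E K) (Ram_O K)].
Proof. exact: (ram_lift_gen ram_square). Qed.

Lemma ram_comul_coproduct : ram_coproduct ram_comul.
Proof.
have [DE DL DO] := ram_comul_gen; have [Dm _ _] := ram_comul_morph.
split; first by apply/operad_comulP/ram_comul_morph.
- move=> T i j h X; rewrite [LHS]Dm DE; exact: gen2_pure.
- move=> T i j h X Y; rewrite [LHS]Dm DL [LHS]gen2_primitive.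
  exact: symtens_irr.
- move=> T i j h X Y; rewrite [LHS]Dm DO [LHS]gen2_primitive.
  exact: symtens_irr.
Qed.

Lemma ram_coproduct_gen (D : forall I, bgcomul (Ram K I)) :
  ram_coproduct D ->
  [/\ D boolF degE (Ram_E K) = grouplike (Ram_E K),
      D boolF degL (Ram_L K) = primitive (Ram_E K) (Ram_L K) &
      D boolF degO (Ram_O K) = primitive (Ram_E K) (Ram_O K)].
Proof.
move=> [_ DE DL DO].
have := DE _ _ _ enum2_bool; have := DL _ _ _ enum2_bool.
have := DO _ _ _ enum2_bool; rewrite /= !gen2_bool => -> -> ->.
by split=> //; apply: symtens_irr.
Qed.

Lemma ram_comul_unique (D : forall I, bgcomul (Ram K I)) :
  ram_coproduct D -> forall I d x, D I d x = ram_comul I d x.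
Proof.
move=> DP; have [DE DL DO] := ram_coproduct_gen DP.
have Dm := (operad_comulP D).1 (ram_coproduct_comul DP).
exact: (ram_lift_unique (M := ram_square) Dm DE DL DO).
Qed.

Lemma ram_comul_coassoc I d (x : Ram K I d) :
  tassoc _ _ _ d (tmap (ram_comul I) (bgid (Ram K I)) d (ram_comul I d x)) =
  tmap (bgid (Ram K I)) (ram_comul I) d (ram_comul I d x).
Proof.
have Dm := ram_comul_morph; have idm := operad_morph_id (Ram K).
have [DE DL DO] := ram_comul_gen.
have lm := operad_morph_comp (operad_morph_tassoc _ _ _)
  (operad_morph_comp (operad_morph_tmap Dm idm) Dm).
have rm := operad_morph_comp (operad_morph_tmap idm Dm) Dm.
have prim a (X : Ram K boolF a) : ram_comul boolF a X = primitive (Ram_E K) X ->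
    tassoc _ _ _ a (tmap (ram_comul boolF) (bgid _) a (ram_comul boolF a X)) =
    tmap (bgid _) (ram_comul boolF) a (ram_comul boolF a X).
  move=> DX; rewrite DX /primitive !linearD !tmap_pure !bgidE DE DX pureDl pureDr.
  rewrite !linearD (tassoc_pure _ _ (add0r _) (add0r _)).
  rewrite (tassoc_pure _ _ (addr0 _) (add0r _)).
  by rewrite (tassoc_pure _ _ degEE (addr0 _)) addrA.
move: I d x; apply: (ram_morph_ext lm rm); rewrite !bgcompE.
- by rewrite DE !tmap_pure !bgidE DE (tassoc_pure _ _ degEE degEE).
- exact: prim DL.
- exact: prim DO.
Qed.

Definition ram_counit : forall I, bgform (Ram K I) :=
  fun I d => (@total K d \o ram_lift (com_model K) I d)%FUN.

Lemma ram_counit_augmentation : augmentation ram_counit.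
Proof.
have [em ec eu] := ram_lift_morph (com_model K).
split=> [I d x d0|I J s d x|I J a b c e x y|].
- exact: total_eq0.
- by congr total; apply: em.
- by rewrite -[RHS](@total_com_comp K I J _ _ _ e); congr total; apply: ec.
- have -> : 1 = total (op_unit (com K)) by rewrite total_const eqxx.
  by congr total; apply: eu.
Qed.

Lemma ram_counit_gen :
  [/\ ram_counit boolF degE (Ram_E K) = 1,
      ram_counit boolF degL (Ram_L K) = 0 &
      ram_counit boolF degO (Ram_O K) = 0].
Proof.
have [eE eL eO] := ram_lift_gen (com_model K).
split; last 2 first.
- by rewrite -[RHS](total0 K degL); congr total; apply: eL.
- by rewrite -[RHS](total0 K degO); congr total; apply: eO.
have -> : 1 = total (const_mx 1 : 'rV[K]_(degE == 0)) by rewrite total_const eqxx.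
by congr total; apply: eE.
Qed.

Lemma ram_counit_l I d (x : Ram K I d) :
  contract_l _ (ram_counit I) d (ram_comul I d x) = x.
Proof.
have [DE DL DO] := ram_comul_gen; have [eE eL eO] := ram_counit_gen.
have lm := operad_morph_comp
  (operad_morph_contract_l (Ram K) ram_counit_augmentation) ram_comul_morph.
move: I d x; apply: (ram_morph_ext lm (operad_morph_id _)); rewrite bgcompE bgidE.
- by rewrite DE contract_l_pure eE scale1r bgcast_id.
- by rewrite DL linearD !contract_l_pure eE eL scale1r scale0r addr0 bgcast_id.
- by rewrite DO linearD !contract_l_pure eE eO scale1r scale0r addr0 bgcast_id.
Qed.

Lemma ram_counit_r I d (x : Ram K I d) :
  contract_r _ (ram_counit I) d (ram_comul I d x) = x.
Proof.
have [DE DL DO] := ram_comul_gen; have [eE eL eO] := ram_counit_gen.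
have rm := operad_morph_comp
  (operad_morph_contract_r (Ram K) ram_counit_augmentation) ram_comul_morph.
move: I d x; apply: (ram_morph_ext rm (operad_morph_id _)); rewrite bgcompE bgidE.
- by rewrite DE contract_r_pure eE scale1r bgcast_id.
- by rewrite DL linearD !contract_r_pure eE eL scale1r scale0r add0r bgcast_id.
- by rewrite DO linearD !contract_r_pure eE eO scale1r scale0r add0r bgcast_id.
Qed.

Lemma ram_hopf : hopf_operad ram_comul ram_counit.
Proof.
have [e0 em ec eu] := ram_counit_augmentation.
split=> [I|||I J d|//].
- split; [exact: e0|exact: ram_comul_coassoc|exact: ram_counit_l|
          exact: ram_counit_r].
- exact: ram_coproduct_comul ram_comul_coproduct.
- by move=> I J f d x; apply: em.
- apply: tens_eq => [k x y|k x y|a b e x y]; first by rewrite !linearP.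
    by rewrite linearP.
  by rewrite /op_comp_map /tform !tlift_pure [LHS]ec.
Qed.

End RamHopf.

Theorem proposition2 (R : realType) :
  exists D : forall I : finSet, bgcomul (Ram R[i]%C I),
    ram_coproduct D /\
    (forall D' : forall I : finSet, bgcomul (Ram R[i]%C I),
       ram_coproduct D' -> forall I d x, D' I d x = D I d x) /\
    (exists eps : forall I : finSet, bgform (Ram R[i]%C I), hopf_operad D eps).
Proof.
exists (ram_comul _); split; first exact: ram_comul_coproduct.
split; first exact: ram_comul_unique.
by exists (ram_counit _); apply: ram_hopf.
Qed.
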